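(* Let $m,n$ be positive integers with $mn$ even, and let $\mathcal{P}_T(m,n)$ be the perfect matching polytope of the $m\times n$ torus graph $\mathcal{G}_T(m,n)$. Then $\mathcal{P}_T(m,n)$ is Gorenstein if and only if, after possibly interchanging $m$ and $n$, either ($m=1$ or $m$ is even) and $n$ is even, or $(m,n)\in\{(2,3),(2,5)\}$.
   Context: The $m\times n$ torus graph $\mathcal{G}_T(m,n)=(V,E)$ is the simple graph with vertex set $V=\{(i,j)\mid 0\le i\le m-1,\ 0\le j\le n-1\}$ in which two distinct vertices $(i,j),(k,l)$ are joined by an edge if $|i-k|+|j-l|=1$, or if $j=l$ and $\{i,k\}=\{0,m-1\}$, or if $i=k$ and $\{j,l\}=\{0,n-1\}$ (coinciding edges are identified and loops are omitted). A perfect matching of a graph $G=(V,E)$ is a set $M\subset E$ of pairwise disjoint edges covering every vertex; its characteristic vector $\chi_M\in\mathbb{R}^E$ has $(\chi_M)_e=1$ if $e\in M$ and $0$ otherwise. The perfect matching polytope of $G$ is $P_G=\mathrm{conv}\{\chi_M\mid M \text{ a perfect matching of } G\}\subset\mathbb{R}^E$, a lattice polytope with respect to $\mathbb{Z}^E$. For a lattice polytope $P\subset\mathbb{R}^N$ of dimension $d$, $L_P(t)=\#(tP\cap\mathbb{Z}^N)$ and $L_{P^\circ}(t)=\#(tP^\circ\cap\mathbb{Z}^N)$, where $P^\circ$ is the relative interior; the Ehrhart series $1+\sum_{t\ge1}L_P(t)z^t$ equals $\frac{\sum_{i=0}^s h_iz^i}{(1-z)^{d+1}}$ with $h_s\neq0$.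 $P$ is called Gorenstein if its Ehrhart ring is Gorenstein; equivalently $h_i=h_{s-i}$ for all $i$; equivalently, with $r=d+1-s$ (the codegree, which is the least $t\ge1$ with $tP^\circ\cap\mathbb{Z}^N\ne\emptyset$), $L_{P^\circ}(r)=1$ and $L_{P^\circ}(t)=L_P(t-r)$ for all $t>r$. *)

(* Defs.v *)
From HB Require Import structures.
From mathcomp Require Import all_boot all_order all_algebra finmap.
From mathcomp Require Import boolp classical_sets functions cardinality reals.
From mathcomp Require Import topology normedtype.

Set Implicit Arguments.
Unset Strict Implicit.
Unset Printing Implicit Defensive.

Import Order.TTheory GRing.Theory Num.Theory.
Import numFieldNormedType.Exports.

Local Open Scope ring_scope.

Section Polytopes.
Local Open Scope classical_set_scope.
Variables (R : realType) (N : nat).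
Implicit Types A P : set 'rV[R]_N.

Definition conv_hull A : set 'rV[R]_N :=
  [set x | exists k (l : 'I_k -> R) (v : 'I_k -> 'rV[R]_N),
    [/\ forall i, A (v i), forall i, 0 <= l i, \sum_i l i = 1
      & x = \sum_i l i *: v i]].

Definition aff_hull A : set 'rV[R]_N :=
  [set x | exists k (l : 'I_k -> R) (v : 'I_k -> 'rV[R]_N),
    [/\ forall i, A (v i), \sum_i l i = 1 & x = \sum_i l i *: v i]].

Definition relint A : set 'rV[R]_N :=
  [set x | aff_hull A x /\ \forall y \near x, aff_hull A y -> A y].

Definition dilate (t : nat) A : set 'rV[R]_N := [set t%:R *: x | x in A].

Definition lattice_points A : set 'rV[int]_N :=
  [set z | A (map_mx intr z)].

(* L_A(t) = #(tA \cap Z^N).  [fset_set] sends infinite sets to the empty one;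
   the count is meaningful for bounded A, in particular for polytopes and their
   relative interiors. *)
Definition ehrhart A (t : nat) : nat :=
  #|` fset_set (lattice_points (dilate t A))|.

Definition is_codegree P (r : nat) : Prop :=
  [/\ (0 < r)%N,
      lattice_points (dilate r (relint P)) !=set0
    & forall t : nat, (0 < t)%N ->
        lattice_points (dilate t (relint P)) !=set0 -> (r <= t)%N].

(* The numerical criterion equivalent to Gorensteinness of the Ehrhart ring,
   in terms of the codegree r:  L_{P°}(r) = 1 and L_{P°}(t) = L_P(t - r). *)
Definition Gorenstein P : Prop :=
  exists r : nat, [/\ is_codegree P r,
    ehrhart (relint P) r = 1%N
  & forall t : nat, (r < t)%N -> ehrhart (relint P) t = ehrhart P (t - r)].

End Polytopes.

Section PerfectMatchings.
Variables (V : finType) (E : {set {set V}}).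

Definition perfect_matching (M : {set {set V}}) : bool :=
  [&& M \subset E, finset.trivIset M & finset.cover M == [set: V]%SET].

(* R^E is represented as 'rV[R]_#|E|, coordinates being numbered by enum_val. *)
Definition char_vec (R : realType) (M : {set {set V}}) : 'rV[R]_#|E| :=
  \row_(k < #|E|) (enum_val k \in M)%:R.

Definition pm_polytope (R : realType) : set 'rV[R]_#|E| :=
  conv_hull [set char_vec R M | M in [set M | perfect_matching M]]%classic.

End PerfectMatchings.

Arguments pm_polytope {V} E R _.

Section TorusGraph.
Local Open Scope nat_scope.
Variables m n : nat.

Definition torus_adj : rel ('I_m * 'I_n) := fun u v =>
  (u != v) &&
  [|| `|u.1 - v.1| + `|u.2 - v.2| == 1,
      (u.2 == v.2) && (((u.1 == 0 :> nat) && (v.1 == m.-1 :> nat))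
                    || ((u.1 == m.-1 :> nat) && (v.1 == 0 :> nat)))
    | (u.1 == v.1) && (((u.2 == 0 :> nat) && (v.2 == n.-1 :> nat))
                    || ((u.2 == n.-1 :> nat) && (v.2 == 0 :> nat)))].

Definition torus_edges : {set {set 'I_m * 'I_n}} :=
  [set e : {set 'I_m * 'I_n} |
    [exists u, exists v, torus_adj u v && (e == [set u; v])]]%SET.

End TorusGraph.

Definition torus_polytope (R : realType) (m n : nat) :
    set 'rV[R]_#|torus_edges m n| :=
  pm_polytope (torus_edges m n) R.

Arguments torus_polytope : clear implicits.

(* Main.v *)
Require Import Defs.
From mathcomp Require Import all_boot all_order all_algebra finmap.
From mathcomp Require Import boolp classical_sets cardinality reals.
From mathcomp Require Import topology normedtype.
From mathcomp Require Import zify ring lra.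

(* Dilations of the perfect matching polytope P are read off from the cone spanned by
   the perfect matchings, the dilation factor being the common vertex sum; the relative
   interior consists of the combinations with positive coefficients.  With p an interior
   lattice point of r P, r minimal, P is Gorenstein exactly when p can be subtracted
   from every interior lattice point of the cone.

   A nonnegative vector with constant vertex sums and bipartite support lies in the cone:
   a vector which is not a multiple of a matching carries a nonzero signed circulation on
   its fractional edges, by a rank count, and can be pushed along it both ways.  This
   settles the bipartite tori, with p = 1.

   Let m be even and n odd.  Deleting one column of horizontal edges makes the torus
   bipartite, which gives enough elements of the cone to avoid Edmonds' theorem: a vector
   with values a on horizontal and b on vertical edges is interior as soon as
   0 < a < (n - 1) b (for m = 2 vertical edges count twice).  If y is a nonnegative
   integral vector with 1 + y interior whose support has an odd component, then y is not
   in the cone and P is not Gorenstein.  For y the rows of the torus this excludes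
   m = 2, n >= 7 and m >= 4, n >= 5; for n = 3, m >= 4 an explicit y with a component on
   five vertices does.  The prisms m = 2, n = 3, 5 are decomposed by hand. *)

Set Implicit Arguments.
Unset Strict Implicit.
Unset Printing Implicit Defensive.

Import Order.TTheory GRing.Theory Num.Theory.
Import numFieldNormedType.Exports.

Local Open Scope ring_scope.

(** * The cone of perfect matchings *)

Section Cone.
Variables (R : realType) (V : finType) (E : {set {set V}}).
Notation pm := (perfect_matching E).
Notation chi := (char_vec E R).
Implicit Types (x y : 'rV[R]_#|E|) (c : {set {set V}} -> R).

(** Coefficients are functions on all sets of edges, so that sign conditions need no side condition;
    only their values at perfect matchings enter. *)
Definition comb c : 'rV[R]_#|E| := \sum_(M | pm M) c M *: chi M.
Definition mass c : R := \sum_(M | pm M) c M.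

Definition cone x := exists2 c, (forall M, 0 <= c M) & x = comb c.
Definition icone x := exists2 c, (forall M, 0 < c M) & x = comb c.

Definition vsum x (u : V) : R := \sum_(k < #|E|) (u \in enum_val k)%:R * x 0 k.

Lemma combD c d : comb (fun M => c M + d M) = comb c + comb d.
Proof. by rewrite -big_split; apply: eq_bigr => M _; rewrite scalerDl. Qed.

Lemma combZ a c : comb (fun M => a * c M) = a *: comb c.
Proof. by rewrite scaler_sumr; apply: eq_bigr => M _; rewrite scalerA. Qed.

Lemma combN c : comb (fun M => - c M) = - comb c.
Proof. by rewrite -sumrN; apply: eq_bigr => M _; rewrite scaleNr. Qed.

Lemma massD c d : mass (fun M => c M + d M) = mass c + mass d.
Proof. by rewrite /mass big_split. Qed.

Lemma massZ a c : mass (fun M => a * c M) = a * mass c.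
Proof. by rewrite /mass mulr_sumr. Qed.

Lemma vsumD x y u : vsum (x + y) u = vsum x u + vsum y u.
Proof. by rewrite -big_split; apply: eq_bigr => k _; rewrite mxE mulrDr. Qed.

Lemma vsumZ a x u : vsum (a *: x) u = a * vsum x u.
Proof. by rewrite mulr_sumr; apply: eq_bigr => k _; rewrite mxE mulrCA. Qed.

Lemma vsumN x u : vsum (- x) u = - vsum x u.
Proof. by rewrite -scaleN1r vsumZ mulN1r. Qed.

Lemma vsumB x y u : vsum (x - y) u = vsum x u - vsum y u.
Proof. by rewrite vsumD vsumN. Qed.

Lemma vsum0 u : vsum 0 u = 0.
Proof. by rewrite -(scale0r 0) vsumZ mul0r. Qed.

Lemma vsum_sum I (r : seq I) (P : pred I) (F : I -> 'rV[R]_#|E|) u :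
  vsum (\sum_(i <- r | P i) F i) u = \sum_(i <- r | P i) vsum (F i) u.
Proof. by elim/big_rec2: _ => [|i a b _ <-]; rewrite ?vsum0 ?vsumD. Qed.

Lemma matching_edge_at (M : {set {set V}}) (u : V) : pm M ->
  exists2 e, e \in M & [set f in M | u \in f]%SET = [set e]%SET.
Proof.
case/and3P=> _ tM /eqP cM; have uM : u \in finset.cover M by rewrite cM inE.
exists (finset.pblock M u); first exact: finset.pblock_mem.
apply/setP=> f; rewrite !inE; apply/andP/eqP => [[fM uf]|->].
  by rewrite (finset.def_pblock tM fM uf).
by rewrite finset.pblock_mem // finset.mem_pblock.
Qed.

Lemma vsum_chi M u : pm M -> vsum (chi M) u = 1.
Proof.
move=> pM; have [e eM He] := matching_edge_at u pM.
have sME : M \subset E by case/and3P: pM.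
rewrite /vsum; under eq_bigr => k _ do rewrite mxE -natrM mulnb.
rewrite -(big_enum_val (A := mem E) (fun f => ((u \in f) && (f \in M))%:R)) /=.
have eE : e \in mem E by apply: (fintype.subsetP sME).
rewrite (bigD1 e) //=.
have : e \in [set f in M | u \in f]%SET by rewrite He inE.
rewrite inE => /andP[_ ->]; rewrite eM big1 ?addr0 // => f /andP[_ fe].
have : f \notin [set f in M | u \in f]%SET by rewrite He inE.
by rewrite inE andbC => /negbTE ->.
Qed.

Lemma vsum_comb c u : vsum (comb c) u = mass c.
Proof.
rewrite vsum_sum; apply: eq_bigr => M pM.
by rewrite vsumZ vsum_chi // mulr1.
Qed.

Lemma comb_ge0 c k : (forall M, 0 <= c M) -> 0 <= comb c 0 k.
Proof.
move=> c0; rewrite summxE; apply: sumr_ge0 => M _.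
by rewrite !mxE mulr_ge0 // ler0n.
Qed.

Lemma comb_le_mass c k : (forall M, 0 <= c M) -> comb c 0 k <= mass c.
Proof.
move=> c0; rewrite summxE; apply: ler_sum => M _.
by rewrite !mxE ler_piMr // lern1 leq_b1.
Qed.

Lemma cone_vsum x u u' : cone x -> vsum x u = vsum x u'.
Proof. by case=> c _ ->; rewrite !vsum_comb. Qed.

Lemma cone_ge0 x k : cone x -> 0 <= x 0 k.
Proof. by case=> c c0 ->; exact: comb_ge0. Qed.

Lemma cone_vsum_ge0 x u : cone x -> 0 <= vsum x u.
Proof. by case=> c c0 ->; rewrite vsum_comb sumr_ge0. Qed.

Lemma cone_le_vsum x k u : cone x -> x 0 k <= vsum x u.
Proof. by case=> c c0 ->; rewrite vsum_comb comb_le_mass. Qed.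

Lemma cone_vsum_eq0 x u : cone x -> vsum x u = 0 -> x = 0.
Proof.
move=> Kx x0; apply/rowP => k; apply/eqP; rewrite mxE.
by rewrite eq_le cone_ge0 // andbT -[leRHS]x0 cone_le_vsum.
Qed.

Lemma coneD x y : cone x -> cone y -> cone (x + y).
Proof.
move=> [c c0 ->] [d d0 ->]; exists (fun M => c M + d M) => [M|].
  by rewrite addr_ge0.
by rewrite combD.
Qed.

Lemma coneZ a x : 0 <= a -> cone x -> cone (a *: x).
Proof.
move=> a0 [c c0 ->]; exists (fun M => a * c M) => [M|].
  by rewrite mulr_ge0.
by rewrite combZ.
Qed.

Lemma cone0 : cone 0.
Proof.
exists (fun=> 0); first by [].
by rewrite /comb big1 // => M _; rewrite scale0r.
Qed.

Lemma cone_sum I (r : seq I) (P : pred I) (F : I -> 'rV[R]_#|E|) :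
  (forall i, P i -> cone (F i)) -> cone (\sum_(i <- r | P i) F i).
Proof. by move=> FK; apply: big_ind => //; [exact: cone0|exact: coneD]. Qed.

Lemma cone_chi M : pm M -> cone (chi M).
Proof.
move=> pM; exists (fun M' => (M' == M)%:R) => [M'|]; first exact: ler0n.
rewrite /comb (bigD1 M) //= eqxx scale1r big1 ?addr0 // => M' /andP[_ /negbTE ->].
by rewrite scale0r.
Qed.

Lemma icone_cone x : icone x -> cone x.
Proof. by case=> c c0 ->; exists c => // M; exact: ltW. Qed.

Lemma iconeD x y : icone x -> cone y -> icone (x + y).
Proof.
move=> [c c0 ->] [d d0 ->]; exists (fun M => c M + d M) => [M|].
  by rewrite ltr_pwDl.
by rewrite combD.
Qed.

Lemma iconeZ a x : 0 < a -> icone x -> icone (a *: x).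
Proof.
move=> a0 [c c0 ->]; exists (fun M => a * c M) => [M|].
  by rewrite mulr_gt0.
by rewrite combZ.
Qed.

Lemma icone_comb1 : icone (comb (fun=> 1)).
Proof. by exists (fun=> 1). Qed.

(** The tool for proving that a vector is interior: remove a small multiple of a known interior
    vector, often the sum of all perfect matchings, and check that the rest is still in the cone. *)
Lemma icone_sub e x y : 0 < e -> icone y -> cone (x - e *: y) -> icone x.
Proof.
move=> e0 Iy Kx; rewrite -(subrK (e *: y) x) addrC.
by apply: iconeD => //; exact: iconeZ.
Qed.

Lemma icone_subP x y : icone x -> cone y -> exists2 e, 0 < e & cone (x - e *: y).
Proof.
move=> [c c0 ->] [d d0 ->].
(* [S] bounds every ratio [d M / c M], so [(1 + S)^-1] times [d] stays below [c] everywhere. *)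
pose S := \sum_M d M / c M.
have S0 : 0 <= S by apply: sumr_ge0 => M _; rewrite divr_ge0 // ltW.
have S1 : 0 < 1 + S by rewrite ltr_pwDl.
exists (1 + S)^-1; first by rewrite invr_gt0.
exists (fun M => c M - (1 + S)^-1 * d M) => [M|]; last first.
  by rewrite combD combN combZ.
rewrite subr_ge0 mulrC ler_pdivrMr // mulrC -ler_pdivrMr //.
rewrite /S (bigD1 M) //= addrCA lerDl addr_ge0 // sumr_ge0 // => M' _.
by rewrite divr_ge0 // ltW.
Qed.

Lemma icone_gt0 x y k : icone x -> cone y -> 0 < y 0 k -> 0 < x 0 k.
Proof.
move=> Ix Ky yk; have [e e0 /(cone_ge0 k)] := icone_subP Ix Ky.
by rewrite !mxE subr_ge0; apply: lt_le_trans; rewrite mulr_gt0.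
Qed.

End Cone.

Arguments comb {R V} E c.
Arguments mass {R V} E c.

(** * The polytope, its dilations and its relative interior in terms of coefficients *)

Section Polytope.
Variables (R : realType) (V : finType) (E : {set {set V}}).
Notation pm := (perfect_matching E).
Notation chi := (char_vec E R).
Notation P := (pm_polytope E R).
Implicit Types (x y : 'rV[R]_#|E|) (c : {set {set V}} -> R).

Lemma hull_comb k (l : 'I_k -> R) (c_ : 'I_k -> {set {set V}} -> R) :
  \sum_i l i *: comb E (c_ i) = comb E (fun M => \sum_i l i * c_ i M).
Proof.
rewrite /comb; under [RHS]eq_bigr => M _ do rewrite scaler_suml.
rewrite [RHS]exchange_big /=; apply: eq_bigr => i _.
by rewrite scaler_sumr; apply: eq_bigr => M _; rewrite scalerA.
Qed.

Lemma hull_mass k (l : 'I_k -> R) (c_ : 'I_k -> {set {set V}} -> R) :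
  (forall i, mass E (c_ i) = 1) ->
  mass E (fun M => \sum_i l i * c_ i M) = \sum_i l i.
Proof.
move=> c1; rewrite /mass exchange_big /=; apply: eq_bigr => i _.
by rewrite -mulr_sumr -/(mass _ _) c1 mulr1.
Qed.

Lemma comb_enum c : let PM := [set M | pm M]%SET in
  comb E c = \sum_(i < #|PM|) c (enum_val i) *: chi (enum_val i).
Proof.
move=> PM; rewrite -(big_enum_val (A := mem PM) (fun M => c M *: chi M)) /=.
by apply: eq_bigl => M; rewrite !inE.
Qed.

Lemma mass_enum c : let PM := [set M | pm M]%SET in
  mass E c = \sum_(i < #|PM|) c (enum_val i).
Proof.
move=> PM; rewrite -(big_enum_val (A := mem PM) c) /=.
by apply: eq_bigl => M; rewrite !inE.
Qed.

(** A matching may repeat in the indexed family of a convex combination; its weights are collected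
    into one coefficient per matching. *)
Lemma pm_polytopeP y :
  P y <-> exists c, [/\ forall M, 0 <= c M, mass E c = 1 & y = comb E c].
Proof.
split=> [[k [l [v [Av l0 l1 ->]]]]|[c [c0 c1 ->]]].
  have /choice[M_ HM] : forall i, exists M, pm M /\ chi M = v i.
    by move=> i; have [M pM <-] := Av i; exists M.
  exists (fun M => \sum_i l i * (M == M_ i)%:R); split.
  - by move=> M; apply: sumr_ge0 => i _; rewrite mulr_ge0.
  - rewrite (@hull_mass k l (fun i M => (M == M_ i)%:R)) // => i.
    rewrite /mass (bigD1 (M_ i)) ?(HM i).1 //= eqxx big1 ?addr0 // => M.
    by case/andP=> _ /negbTE ->.
  - rewrite -(hull_comb l (fun i M => (M == M_ i)%:R)); apply: eq_bigr => i _.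
    rewrite /comb (bigD1 (M_ i)) ?(HM i).1 //= eqxx big1 => [|M].
      by rewrite addr0 scale1r (HM i).2.
    by case/andP=> _ /negbTE ->; rewrite scale0r.
exists #|[set M | pm M]%SET|, (fun i => c (enum_val i)), (fun i => chi (enum_val i)).
split => // [i||]; [|by rewrite -mass_enum|by rewrite comb_enum].
by exists (enum_val i) => //=; have := enum_valP i; rewrite inE.
Qed.

Lemma aff_hullP y :
  aff_hull P y <-> exists c, mass E c = 1 /\ y = comb E c.
Proof.
split=> [[k [l [v [Av l1 ->]]]]|[c [c1 ->]]].
  have /choice[c_ Hc] : forall i, exists c, mass E c = 1 /\ v i = comb E c.
    by move=> i; have /pm_polytopeP[c [_ c1 vi]] := Av i; exists c.
  exists (fun M => \sum_i l i * c_ i M); split.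
    by rewrite hull_mass // => i; case: (Hc i).
  by rewrite -hull_comb; apply: eq_bigr => i _; rewrite (Hc i).2.
exists #|[set M | pm M]%SET|, (fun i => c (enum_val i)), (fun i => chi (enum_val i)).
split => // [i||]; [|by rewrite -mass_enum|by rewrite comb_enum].
have pM : pm (enum_val i) by have := enum_valP i; rewrite inE.
apply/pm_polytopeP; exists (fun M => (M == enum_val i)%:R); split => //.
  rewrite /mass (bigD1 (enum_val i)) //= eqxx big1 ?addr0 // => M.
  by case/andP=> _ /negbTE ->.
rewrite /comb (bigD1 (enum_val i)) //= eqxx big1 => [|M].
  by rewrite addr0 scale1r.
by case/andP=> _ /negbTE ->; rewrite scale0r.
Qed.

(** Each matching covers [u] exactly once, so the sum at [u] is the total mass of the coefficients,
    whatever representation is chosen. *)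
Lemma dilate_polytopeP (u : V) (t : nat) x : (0 < t)%N ->
  dilate t P x <-> cone x /\ vsum x u = t%:R.
Proof.
move=> t0; have t0' : t%:R != 0 :> R by rewrite pnatr_eq0 -lt0n.
split=> [[y /pm_polytopeP[c [c0 c1 ->]] <-]|[[c c0 ->]]].
  split; first by apply: coneZ => //; exists c.
  by rewrite vsumZ vsum_comb c1 mulr1.
rewrite vsum_comb => ct; exists (t%:R^-1 *: comb E c).
  apply/pm_polytopeP; exists (fun M => t%:R^-1 * c M); split.
  - by move=> M; rewrite mulr_ge0 // invr_ge0.
  - by rewrite massZ ct mulVf.
  - by rewrite combZ.
by rewrite scalerA mulfV // scale1r.
Qed.

(* The coefficients of a vector of the linear span depend linearly on it, through [pinvmx]. *)
Lemma small_comb (e : R) : 0 < e -> exists2 d : R, 0 < d &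
  forall c, (forall k, `|comb E c 0 k| <= d) ->
    exists2 c', (forall M, `|c' M| <= e) & comb E c' = comb E c.
Proof.
move=> e0; pose T : finType := {set {set V}}.
pose A : 'M[R]_(#|T|, #|E|) :=
  \matrix_(i, k) (if pm (enum_val i) then chi (enum_val i) 0 k else 0).
have combA c : comb E c = (\row_i c (enum_val i)) *m A.
  apply/rowP=> k; rewrite /comb summxE big_mkcond /= mxE.
  rewrite (big_enum_val (A := mem T) (fun M => if pm M then (c M *: chi M) 0 k else 0)) /=.
  by apply: eq_bigr => i _; rewrite !mxE; case: ifP => _; rewrite ?mulr0 // !mxE.
pose B := \sum_i \sum_j `|pinvmx A i j|.
have B0 : 0 <= B by do 2!apply: sumr_ge0 => ? _.
exists (e / (1 + B)); first by rewrite divr_gt0 // ltr_pwDl.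
move=> c cd; pose c' M := (comb E c *m pinvmx A) 0 (enum_rank M).
exists c'; last first.
  have -> : comb E c' = (comb E c *m pinvmx A) *m A.
    rewrite combA; congr (_ *m A); apply/rowP => i.
    by rewrite mxE /c' enum_valK.
  by rewrite mulmxKpV // combA submxMl.
move=> M; rewrite /c' mxE; apply: le_trans (ler_norm_sum _ _ _) _.
apply: (@le_trans _ _ (e / (1 + B) * B)); last first.
  rewrite mulrAC ler_pdivrMr ?ltr_pwDl // ler_wpM2l ?lerDr //; exact: ltW.
rewrite mulr_sumr; apply: ler_sum => k _; rewrite normrM.
apply: ler_pM => //.
by rewrite (bigD1 (enum_rank M)) //= lerDl; apply: sumr_ge0.
Qed.

(** A nearby point of the affine hull differs from [y] by a vector of the span with small entries.
    By [small_comb] this difference has coefficients too small to make those of [y] negative. *)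
Lemma icone_relint y u : icone y -> vsum y u = 1 -> relint P y.
Proof.
move=> [c c0 ->]; rewrite vsum_comb => c1; split.
  by apply/aff_hullP; exists c.
have [e e0 He] : exists2 e : R, 0 < e & forall M, e <= c M.
  (* The reciprocal of the sum of reciprocals lies below every coefficient; [finset.set0] merely
     supplies a positive term of the sum. *)
  exists (\sum_M (c M)^-1)^-1.
    rewrite invr_gt0 (bigD1 finset.set0) //= ltr_pwDl ?invr_gt0 //.
    by apply: sumr_ge0 => M _; rewrite invr_ge0 ltW.
  move=> M; rewrite invf_ple ?posrE //; last first.
    rewrite (bigD1 finset.set0) //= ltr_pwDl ?invr_gt0 //.
    by apply: sumr_ge0 => ? _; rewrite invr_ge0 ltW.
  rewrite (bigD1 M) //= lerDl.
  by apply: sumr_ge0 => ? _; rewrite invr_ge0 ltW.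
have [d d0 Hd] := small_comb e0.
apply/nbhs_ballP; exists d => //= y' [_ yb] /aff_hullP[c' [c'1 yc']].
have yd k : `|comb E (fun M => c' M - c M) 0 k| <= d.
  rewrite combD combN -yc' mxE [X in _ + X]mxE distrC; apply: ltW.
  by have := yb 0 k; rewrite -ball_normE.
have [c2 c2e c2E] := Hd _ yd.
have yE : y' = comb E (fun M => c M + c2 M).
  by rewrite combD c2E combD combN -yc' addrC subrK.
apply/pm_polytopeP; exists (fun M => c M + c2 M); split => //.
- move=> M; have := c2e M; rewrite ler_norml => /andP[+ _].
  rewrite lerNl => h; rewrite -lerBlDr sub0r; exact: le_trans h (He M).
- by rewrite -(vsum_comb _ _ u) -yE yc' vsum_comb.
Qed.

(** The segment from the barycentre [b] of the matchings to [y] can be prolonged a little beyond [y]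
    inside the polytope. So [y] is a positive combination of [b], all of whose coefficients are
    positive, and a point of the polytope. *)
Lemma relint_icone y : relint P y -> icone y.
Proof.
move=> [/aff_hullP[c [c1 yc]] /nbhs_ballP[e /= e0 He]].
pose n : R := \sum_(M | pm M) 1.
(* Some perfect matching exists, since an empty sum could not have mass 1. *)
have n0 : 0 < n.
  rewrite lt_neqAle sumr_ge0 // andbT; apply/eqP => n0.
  have := oner_neq0 R; rewrite -c1 /mass big1 ?eqxx // => M pM.
  have : n != 0 by rewrite /n (bigD1 M) //= gt_eqF // ltr_pwDl // sumr_ge0.
  by rewrite -n0 eqxx.
pose b := comb E (fun=> n^-1).
have Ib : icone b by exists (fun=> n^-1) => // M; rewrite invr_gt0.
have b1 : mass E (fun=> n^-1) = 1.
  rewrite -[RHS](mulVf (lt0r_neq0 n0)) mulr_sumr.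
  by apply: eq_bigr => M _; rewrite mulr1.
pose S := \sum_k `|y 0 k - b 0 k|.
have S0 : 0 <= S by apply: sumr_ge0.
pose d := e / (1 + S).
have d0 : 0 < d by rewrite divr_gt0 // ltr_pwDl.
have /pm_polytopeP[c' [c'0 _ yc']] : P (y + d *: (y - b)).
  apply: He.
    split=> // i k; rewrite (ord1 i) -ball_normE /= !mxE opprD addrA subrr sub0r normrN.
    rewrite normrM gtr0_norm // /d mulrAC ltr_pdivrMr ?ltr_pwDl // ltr_pM2l //.
    rewrite ltr_pwDl // /S (bigD1 k) //= lerDl; exact: sumr_ge0.
  apply/aff_hullP; exists (fun M => (1 + d) * c M + (- d) * n^-1); split.
    by rewrite massD !massZ c1 b1; ring.
  rewrite combD !combZ -/b -yc scalerBr scalerDl scale1r addrA.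
  by rewrite scaleNr.
have d1 : 0 < 1 + d by rewrite addr_gt0.
have -> : y = (1 + d)^-1 *: (d *: b + (y + d *: (y - b))).
  by apply/rowP => k; rewrite !mxE; field; rewrite gt_eqF.
apply: iconeZ; first by rewrite invr_gt0.
by apply: iconeD; [exact: iconeZ|exists c'].
Qed.

Lemma dilate_relintP (u : V) (t : nat) x : (0 < t)%N ->
  dilate t (relint P) x <-> icone x /\ vsum x u = t%:R.
Proof.
move=> t0; have t0' : 0 < t%:R :> R by rewrite ltr0n.
split=> [[y Ry <-]|[Ix xt]].
  have Iy := relint_icone Ry; split; first exact: iconeZ.
  case: Ry => /aff_hullP[c [c1 ->]] _.
  by rewrite vsumZ vsum_comb c1 mulr1.
exists (t%:R^-1 *: x); last by rewrite scalerA mulfV ?gt_eqF // scale1r.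
apply: (@icone_relint _ u); first by apply: iconeZ => //; rewrite invr_gt0.
by rewrite vsumZ xt mulVf // gt_eqF.
Qed.

End Polytope.

(** * Lattice points and Gorenstein criteria *)

Section Criteria.
Variables (R : realType) (V : finType) (E : {set {set V}}) (u : V).
Notation P := (pm_polytope E R).
Notation toR := (@map_mx int R intr 1 #|E|).
Implicit Types (p w z : 'rV[int]_#|E|).

Lemma vsum_toR z :
  vsum (toR z) u = (\sum_(k < #|E|) (u \in enum_val k)%:R * z 0 k)%:~R.
Proof.
rewrite rmorph_sum /=; apply: eq_bigr => k _.
by rewrite mxE rmorphM /= rmorph_nat.
Qed.

(** Entries lie between 0 and [t]. Finiteness makes the cardinal of [fset_set] the true count. *)
Lemma finite_lattice_points (t : nat) : (0 < t)%N ->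
  finite_set (lattice_points (dilate t P)).
Proof.
move=> t0; pose g (f : {ffun 'I_#|E| -> 'I_t.+1}) : 'rV[int]_#|E| :=
  \row_k (f k : nat)%:Z.
apply: (@sub_finite_set _ _ (range g)); last exact: finite_image.
move=> z /= /(dilate_polytopeP u _ t0)[Kz zt].
exists [ffun k => inord (absz (z 0 k))] => //; apply/rowP => k; rewrite mxE ffunE.
have z0 : 0 <= z 0 k by have := cone_ge0 k Kz; rewrite mxE ler0z.
have zk : z 0 k <= t%:Z.
  by have := cone_le_vsum k u Kz; rewrite zt mxE -[t%:R]/(t%:Z%:~R) ler_int.
by rewrite inordK ?gez0_abs // ltnS -lez_nat gez0_abs.
Qed.

Lemma finite_interior_lattice_points (t : nat) : (0 < t)%N ->
  finite_set (lattice_points (dilate t (relint P))).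
Proof.
move=> t0; apply: sub_finite_set (finite_lattice_points t0) => z /=.
move=> /(dilate_relintP u _ t0)[Iz zt]; apply/(dilate_polytopeP u) => //.
by split => //; exact: icone_cone.
Qed.

(** Since [z - p] has nonnegative vertex sum, [r] is the codegree, and vertex sum [r] forces
    [z = p]. Translation by [p] then identifies the lattice points of the dilation by [t - r] with
    the interior ones of the dilation by [t]. *)
Lemma Gorenstein_intro p (r : nat) : (0 < r)%N ->
  icone (toR p) -> vsum (toR p) u = r%:R ->
  (forall z, icone (toR z) -> cone (toR (z - p))) ->
  Gorenstein P.
Proof.
move=> r0 Ip pr Hp.
have ler z (t : nat) : icone (toR z) -> vsum (toR z) u = t%:R -> (r <= t)%N.
  move=> Iz zt; have := cone_vsum_ge0 u (Hp _ Iz).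
  by rewrite map_mxB vsumB zt pr subr_ge0 ler_nat.
exists r; split.
- split=> //; first by exists p; apply/(dilate_relintP u).
  by move=> t t0 [z /(dilate_relintP u _ t0)[Iz zt]]; exact: ler zt.
- rewrite /ehrhart; have -> : lattice_points (dilate r (relint P)) = [set p]%classic.
    apply/seteqP; split=> z /=; last by move=> ->; apply/(dilate_relintP u).
    move=> /(dilate_relintP u _ r0)[Iz zr].
    have h : toR (z - p) = 0.
      by apply: (@cone_vsum_eq0 _ _ _ _ u (Hp _ Iz)); rewrite map_mxB vsumB zr pr subrr.
    by apply/eqP; rewrite -subr_eq0; apply/eqP/rowP => k;
    move/rowP/(_ k): h; rewrite !mxE => /eqP; rewrite intr_eq0 => /eqP.
  by rewrite fset_set1 cardfs1.
- move=> t rt; rewrite /ehrhart.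
  have tr0 : (0 < t - r)%N by rewrite subn_gt0.
  have -> : lattice_points (dilate t (relint P)) =
    ((fun z => z + p) @` lattice_points (dilate (t - r) P))%classic.
    apply/seteqP; split=> z /=.
      move=> /(dilate_relintP u _ (leq_trans r0 (ltnW rt)))[Iz zt].
      exists (z - p); last by rewrite subrK.
      apply/(dilate_polytopeP u) => //; split; first exact: Hp.
      by rewrite map_mxB vsumB zt pr natrB // ltnW.
    move=> [y /(dilate_polytopeP u _ tr0)[Ky yt] <-].
    apply/(dilate_relintP u); first exact: leq_trans r0 (ltnW rt).
    rewrite map_mxD vsumD yt pr -natrD subnK 1?ltnW //; split => //.
    by rewrite addrC; exact: iconeD.
  rewrite fset_set_image; last exact: finite_lattice_points.
  by rewrite card_imfset //; exact: addIr.
Qed.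

(** Translation by [p] still injects the lattice points for [t - r] into the interior ones for [t],
    but it misses [w], so the two counts differ. *)
Lemma not_Gorenstein p w (r : nat) : (0 < r)%N ->
  icone (toR p) -> vsum (toR p) u = r%:R ->
  (forall z, icone (toR z) -> r%:R <= vsum (toR z) u) ->
  icone (toR w) -> ~ cone (toR (w - p)) ->
  ~ Gorenstein P.
Proof.
move=> r0 Ip pr Hp Iw Hw [r' [[r'0 [z /(dilate_relintP u _ r'0)[Iz zr']] minr'] e1 et]].
have r'E : r' = r.
  apply/eqP; rewrite eqn_leq; apply/andP; split.
    by apply: minr' => //; exists p; apply/(dilate_relintP u).
  by have := Hp _ Iz; rewrite zr' ler_nat.
rewrite {r' r'0 minr' zr'}r'E in e1 et.
have [t wt] : exists t : nat, vsum (toR w) u = t%:R.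
  have := cone_vsum_ge0 u (icone_cone Iw); rewrite vsum_toR ler0z.
  by case: (\sum_ _ _) => // t _; exists t.
have rt : (r <= t)%N by have := Hp _ Iw; rewrite wt ler_nat.
have t0 := leq_trans r0 rt.
have wA : w \in fset_set (lattice_points (dilate t (relint P))).
  rewrite in_fset_set; last exact: finite_interior_lattice_points.
  by rewrite inE /=; apply/(dilate_relintP u).
(* If [w] has vertex sum [r], uniqueness of the interior point gives [w = p], and [w - p = 0] lies
   in the cone. *)
move: rt; rewrite leq_eqVlt => /orP[/eqP rt|rt].
  move/eqP/cardfs1P: e1 => [q Hq].
  have : p \in fset_set (lattice_points (dilate r (relint P))).
    rewrite in_fset_set; last exact: finite_interior_lattice_points.
    by rewrite inE /=; apply/(dilate_relintP u).
  rewrite Hq inE => /eqP pq; move: wA; rewrite -rt Hq inE => /eqP wq.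
  by apply: Hw; rewrite pq wq subrr map_mx0; exact: cone0.
have tr0 : (0 < t - r)%N by rewrite subn_gt0.
have fin := finite_lattice_points tr0.
pose B := ((fun z => (z + p)%R) @` fset_set (lattice_points (dilate (t - r) P)))%fset.
have cB : #|` B| = ehrhart P (t - r) by rewrite card_imfset //; exact: addIr.
have wB : w \notin B.
  apply/negP => /imfsetP[/= y]; rewrite in_fset_set // inE /=.
  move=> /(dilate_polytopeP u _ tr0)[Ky _] wy.
  by apply: Hw; rewrite wy addrK.
have : (#|` (w |` B)%fset| <= ehrhart (relint P) t)%N.
  apply: fsubset_leq_card; rewrite fsubUset fsub1set wA /=.
  apply/fsubsetP => y /imfsetP[/= y']; rewrite in_fset_set // inE /=.
  move=> /(dilate_polytopeP u _ tr0)[Ky y't] ->.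
  rewrite in_fset_set; last exact: finite_interior_lattice_points.
  rewrite inE /=; apply/(dilate_relintP u) => //.
  rewrite map_mxD vsumD y't pr -natrD subnK 1?ltnW //; split => //.
  by rewrite addrC; exact: iconeD.
by rewrite et // cardfsU1 wB cB add1n ltnn.
Qed.

End Criteria.

(** * Vectors with bipartite support *)

Section Bipartite.
Variables (R : realType) (V : finType) (E : {set {set V}}) (col : V -> bool).
Implicit Types (x d : 'rV[R]_#|E|).

Definition bichromatic (e : {set V}) :=
  exists a b, e = [set a; b]%SET /\ col a != col b.

Definition supp x : {set 'I_#|E|} := [set k | x 0 k != 0]%SET.

Lemma le_vsum x u (k : 'I_#|E|) : (forall k, 0 <= x 0 k) ->
  u \in enum_val k -> x 0 k <= vsum x u.
Proof.
move=> x0 uk; rewrite /vsum (bigD1 k) //= uk mul1r lerDl.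
by apply: sumr_ge0 => l _; rewrite mulr_ge0.
Qed.

Lemma le_vsum2 x u (k l : 'I_#|E|) : (forall k, 0 <= x 0 k) -> k != l ->
  u \in enum_val k -> u \in enum_val l -> x 0 k + x 0 l <= vsum x u.
Proof.
move=> x0 kl uk ul; rewrite /vsum (bigD1 k) //= uk mul1r lerD2l.
rewrite (bigD1 l) 1?eq_sym //= ul mul1r lerDl.
by apply: sumr_ge0 => ? _; rewrite mulr_ge0.
Qed.

(** The ratio test of the simplex method: move along [d] until the first decreasing entry reaches 0.
    No new entry enters the support, because [d] vanishes off it. *)
Lemma push_to_boundary x d : (forall k, 0 <= x 0 k) ->
  (forall k, x 0 k = 0 -> d 0 k = 0) -> (exists k, d 0 k < 0) ->
  exists2 l, 0 < l & (forall k, 0 <= (x + l *: d) 0 k) /\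
    (#|supp (x + l *: d)| < #|supp x|)%N.
Proof.
move=> x0 xd [k0 dk0].
have xgt k : d 0 k < 0 -> 0 < x 0 k.
  move=> dk; rewrite lt_neqAle x0 andbT eq_sym; apply/eqP => /xd dk'.
  by rewrite dk' ltxx in dk.
case: (@arg_minP _ R _ k0 (fun k => d 0 k < 0) (fun k => x 0 k / - d 0 k) dk0).
move=> k1 dk1 kmin.
exists (x 0 k1 / - d 0 k1); first by rewrite divr_gt0 ?xgt // oppr_gt0.
split.
  move=> k; rewrite !mxE; have [dk|dk] := ltP (d 0 k) 0; last first.
    rewrite addr_ge0 // mulr_ge0 // divr_ge0 //.
    by rewrite oppr_ge0 ltW.
  have := kmin _ dk; rewrite ler_pdivlMr ?oppr_gt0 // mulrN.
  by rewrite -subr_ge0 opprK.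
apply: proper_card; apply/fintype.properP; split.
  apply/fintype.subsetP => k; rewrite !inE; apply: contra => /eqP xk.
  by rewrite !mxE xk (xd k) // mulr0 addr0.
exists k1; rewrite !inE; first by rewrite gt_eqF ?xgt.
rewrite negbK !mxE; apply/eqP; field.
by rewrite lt_eqF.
Qed.

(** Let [F] be the edges with value strictly between 0 and [s], and [W] the vertices they cover.
    Then [W] is no larger than [F], while bipartiteness keeps the rank of the incidence matrix below
    the size of [W]; a linear relation between its rows is the required [d]. *)
Lemma fractional_circulation x s : 0 < s ->
  (forall k, 0 <= x 0 k) -> (forall u, vsum x u = s) ->
  (forall k, x 0 k != 0 -> bichromatic (enum_val k)) ->
  (exists k, (0 < x 0 k) && (x 0 k < s)) ->
  exists2 d : 'rV[R]_#|E|, d != 0 & (forall k, x 0 k = 0 -> d 0 k = 0) /\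
    (forall u, vsum d u = 0).
Proof.
move=> s0 x0 xs xb [kF HkF].
pose F := [set k | (0 < x 0 k) && (x 0 k < s)]%SET.
have kFF : kF \in F by rewrite inE.
pose W := [set u | [exists k in F, u \in enum_val k]]%SET.
have inW k u : k \in F -> u \in enum_val k -> u \in W.
  by move=> Fk uk; rewrite inE; apply/existsP; exists k; rewrite Fk.
have Fb k : k \in F -> bichromatic (enum_val k).
  by rewrite inE => /andP[xk _]; apply: xb; rewrite gt_eqF.
have F2 k : k \in F -> #|enum_val k| = 2%N.
  move=> /Fb[a [b [-> ab]]]; rewrite cards2.
  by have /negbTE -> : a != b by apply: contra ab => /eqP ->.
(* One edge of value below [s] cannot give the sum [s], so a second positive edge meets [u]; it is
   below [s] because the first is positive. *)
have W2 u : u \in W -> (2 <= #|[set k in F | u \in enum_val k]|)%N.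
  rewrite inE => /existsP[k /andP[Fk uk]].
  have : exists2 l, l != k & (u \in enum_val l) && (0 < x 0 l).
    apply: contrapT => /forall2NP nl.
    have := xs u; rewrite /vsum (bigD1 k) //= uk mul1r big1 ?addr0 => [xk|l lk].
      by move: Fk; rewrite inE xk ltxx andbF.
    have [//|/negP] := nl l; rewrite negb_and -leNgt => /orP[/negbTE ->|xl].
      by rewrite mul0r.
    by have -> : x 0 l = 0 by [apply/eqP; rewrite eq_le xl x0]; rewrite mulr0.
  case=> l lk /andP[ul xl].
  have Fl : l \in F.
    rewrite inE xl /= -(xs u).
    move: Fk; rewrite inE => /andP[xk _].
    by apply: lt_le_trans (le_vsum2 x0 lk ul uk); rewrite ltrDl.
  have <- : #|[set k; l]%SET| = 2%N by rewrite cards2 eq_sym lk.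
  apply: subset_leq_card; apply/fintype.subsetP => i.
  by rewrite !inE => /orP[]/eqP ->; [rewrite uk andbT|rewrite ul andbT]; move: Fk Fl; rewrite !inE.
(* Double counting of incidences: at least 2 per vertex of [W], at most 2 per edge of [F]. *)
have WF : (#|W| <= #|F|)%N.
  rewrite -(@leq_pmul2r 2) // -[in leqRHS](sum1_card (mem F)) big_distrl /=.
  rewrite -sum1_card big_distrl /=.
  apply: (@leq_trans (\sum_(u in W) \sum_(k in F) (u \in enum_val k))%N).
    apply: leq_sum => u /W2; rewrite mul1n => /leq_trans; apply.
    rewrite -sum1_card big_mkcond [leqRHS]big_mkcond /=.
    by apply: leq_sum => k _; rewrite finset.in_set; case: (k \in F); case: (u \in enum_val k).
  rewrite exchange_big /=; apply: leq_sum => k Fk.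
  rewrite mul1n -(F2 k Fk) -sum1_card [leqRHS]big_mkcond [leqLHS]big_mkcond /=.
  by apply: leq_sum => u _; case: (u \in W); case: (u \in enum_val k).
pose sg u : R := (-1) ^+ col u.
pose eF (i : 'I_#|F|) : {set V} := enum_val (enum_val i).
pose eW (j : 'I_#|W|) : V := enum_val j.
pose B : 'M[R]_(#|F|, #|W|) := \matrix_(i, j) ((eW j \in eF i)%:R * sg (eW j)).
(* With signs given by the colours, the two ends of an edge cancel in each row. *)
have B1 : B *m const_mx 1 = 0 :> 'cV_#|F|.
  apply/colP => i; rewrite !mxE.
  have Fi := enum_valP i; have [a [b [iab ab]]] := Fb _ Fi.
  under eq_bigr => j _ do rewrite mxE mxE mulr1.
  rewrite -(big_enum_val (A := mem W) (fun u => (u \in eF i)%:R * sg u)) /= /eF iab.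
  have ab' : b != a by apply: contra ab => /eqP ->.
  have aW : a \in W by apply: inW Fi _; rewrite iab !inE eqxx.
  have bW : b \in W by apply: inW Fi _; rewrite iab !inE eqxx orbT.
  rewrite (bigD1 a) //= (bigD1 b) /= ?bW // big1 => [|u /andP[/andP[_ ua] ub]].
    rewrite !inE !eqxx orbT !mul1r addr0 /sg.
    by case: (col a) (col b) ab => [] [] // _; rewrite !expr1 expr0 ?subrr ?addNr.
  by rewrite !inE (negbTE ua) (negbTE ub) mul0r.
have W0 : (0 < #|W|)%N.
  have [a [b [iab _]]] := Fb _ kFF; apply/card_gt0P; exists a.
  by apply: inW kFF _; rewrite iab !inE eqxx.
have nfull : ~~ row_full B.
  apply/negP => /row_fullP[B' B'B].
  have : B' *m (B *m const_mx 1) = const_mx 1 :> 'cV_#|W|.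
    by rewrite mulmxA B'B mul1mx.
  rewrite B1 mulmx0 => /colP/(_ (Ordinal W0)); rewrite !mxE => /eqP.
  by rewrite eq_sym oner_eq0.
have nfree : kermx B != 0.
  rewrite kermx_eq0; apply: contra nfull => /eqP rB; rewrite /row_full.
  by rewrite eqn_leq rank_leq_col /= rB.
have [v vB v0] := rowV0Pn nfree; move/sub_kermxP in vB.
pose d : 'rV[R]_#|E| := \row_k \sum_i (enum_val i == k)%:R * v 0 i.
have dE i : d 0 (enum_val i) = v 0 i.
  rewrite mxE (bigD1 i) //= eqxx mul1r big1 ?addr0 // => j ji.
  by rewrite (inj_eq enum_val_inj) (negbTE ji) mul0r.
have d0 k : k \notin F -> d 0 k = 0.
  move=> kF'; rewrite mxE big1 // => i _; case: eqP => [ik|]; last by rewrite mul0r.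
  by move: kF'; rewrite -ik enum_valP.
exists d.
  apply: contra v0 => /eqP d00; apply/eqP/rowP => i.
  by rewrite -dE d00 !mxE.
split=> [k xk|u]; first by apply: d0; rewrite inE xk ltxx.
have -> : vsum d u = \sum_i (u \in eF i)%:R * v 0 i.
  under [RHS]eq_bigr => i _ do rewrite -dE.
  rewrite -(big_enum_val (A := mem F) (fun k => (u \in enum_val k)%:R * d 0 k)) /=.
  rewrite [RHS]big_mkcond /=; apply: eq_bigr => k _.
  by case: ifPn => // /d0 ->; rewrite mulr0.
have [uW|uW] := boolP (u \in W); last first.
  apply: big1 => i _; have := enum_valP i => Fi.
  case: (boolP (u \in _)) => [ui|_]; last by rewrite mul0r.
  by rewrite (inW _ _ Fi ui) in uW.
have /rowP/(_ (enum_rank_in uW u)) := vB; rewrite !mxE.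
under eq_bigr => i _ do rewrite mxE /eW enum_rankK_in // mulrA.
rewrite -mulr_suml => /eqP; rewrite mulf_eq0 orbC signr_eq0 /= => /eqP vB0.
by rewrite -[RHS]vB0; apply: eq_bigr => i _; rewrite mulrC.
Qed.

(** The edges of value [s] form a perfect matching: two at one vertex would exceed the sum [s], and
    a vertex without any would have sum 0. *)
Lemma integral_cone x s : 0 < s ->
  (forall k, 0 <= x 0 k) -> (forall u, vsum x u = s) ->
  (forall k, x 0 k != 0 -> x 0 k = s) -> cone x.
Proof.
move=> s0 x0 xs xi.
pose M := [set enum_val k | k in [set k | x 0 k == s]%SET]%SET.
have inM k : (enum_val k \in M) = (x 0 k == s).
  by rewrite mem_imset ?inE //; exact: enum_val_inj.
have pM : perfect_matching E M.
  apply/and3P; split.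
  - by apply/fintype.subsetP => e /imsetP[k _ ->]; exact: enum_valP.
  - apply/finset.trivIsetP => e f /imsetP[k + ->] /imsetP[l + ->].
    rewrite !inE => /eqP xk /eqP xl kl.
    rewrite -setI_eq0; apply/set0Pn => -[u]; rewrite inE => /andP[uk ul].
    have kl' : k != l by apply: contra kl => /eqP ->.
    have := le_vsum2 x0 kl' uk ul; rewrite xk xl xs.
    by apply/negP; rewrite -ltNge ltrDl.
  - rewrite finset.eqEsubset finset.subsetT /=; apply/fintype.subsetP => u _.
    have [k] : exists k : 'I_#|E|, (u \in enum_val k) && (x 0 k != 0).
      apply: contrapT => /forallNP nk; have := xs u; rewrite /vsum big1.
        by move=> s00; rewrite -s00 ltxx in s0.
      move=> k _; have /negP := nk k; rewrite negb_and negbK => /orP[/negbTE ->|/eqP ->].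
        by rewrite mul0r.
      by rewrite mulr0.
    move=> /andP[uk /xi xk]; apply/finset.bigcupP; exists (enum_val k) => //.
    by rewrite inM xk.
have -> : x = s *: char_vec E R M.
  apply/rowP => k; rewrite !mxE inM; have [->|xk] := eqVneq (x 0 k) s.
    by rewrite mulr1.
  by rewrite mulr0; apply/eqP; apply: contraNT xk => /xi ->.
by apply: coneZ; [exact: ltW|exact: cone_chi].
Qed.

(** Induction on the size of the support: pushing [x] along a circulation and along its negative
    gives two vectors of smaller support, and [x] is a convex combination of them. *)
Lemma bipartite_cone x s : (forall k, 0 <= x 0 k) ->
  (forall u, vsum x u = s) ->
  (forall k, x 0 k != 0 -> bichromatic (enum_val k)) -> cone x.
Proof.
move=> x0 xs xb.
have [s0|s0] := ltP 0 s; last first.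
  suff -> : x = 0 by exact: cone0.
  apply/rowP => k; rewrite mxE; apply/eqP; apply: contraT => xk.
  have [a [b [kab _]]] := xb _ xk.
  have ak : a \in enum_val k by rewrite kab !inE eqxx.
  have := le_trans (le_vsum x0 ak) (_ : _ <= 0); rewrite xs => /(_ s0).
  by rewrite leNgt lt_neqAle eq_sym xk x0.
have [N] := ubnP #|supp x|; elim: N x x0 xs xb => // N IH x x0 xs xb xN.
have [xF|nF] := pselect (exists k, (0 < x 0 k) && (x 0 k < s)); last first.
  apply: (integral_cone s0) => // k xk; apply/eqP; rewrite eq_le; apply/andP; split.
    have [a [b [kab _]]] := xb _ xk.
    by rewrite -(xs a); apply: le_vsum => //; rewrite kab !inE eqxx.
  rewrite leNgt; apply/negP => xks; apply: nF; exists k.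
  by rewrite xks lt_neqAle eq_sym xk x0.
have [d d0 [xd dv]] := fractional_circulation s0 x0 xs xb xF.
have step (d' : 'rV[R]_#|E|) : d' != 0 -> (forall k, x 0 k = 0 -> d' 0 k = 0) ->
    (forall u, vsum d' u = 0) -> exists2 l, 0 < l & cone (x + l *: d').
  move=> d'0 xd' d'v.
  (* A nonzero nonnegative vector would have a positive vertex sum at an end of some edge. *)
  have : exists k, d' 0 k < 0.
    apply: contrapT => /forallNP nd.
    have d'ge k : 0 <= d' 0 k by rewrite leNgt; apply/negP/nd.
    have /rV0Pn[k d'k] := d'0.
    have xk : x 0 k != 0 by apply: contra d'k => /eqP /xd' ->.
    have [a [b [kab _]]] := xb _ xk.
    have ak : a \in enum_val k by rewrite kab !inE eqxx.
    have := le_vsum d'ge ak; rewrite d'v leNgt lt_neqAle eq_sym d'k.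
    by rewrite d'ge.
  move=> /(push_to_boundary x0 xd')[l l0 [xl sl]]; exists l => //.
  apply: IH => //.
  - by move=> u; rewrite vsumD vsumZ d'v mulr0 addr0.
  - move=> k; rewrite !mxE => xlk; apply: xb; apply: contra xlk => /eqP xk.
    by rewrite xk (xd' k) // mulr0 addr0.
  - by apply: leq_trans sl _; rewrite -ltnS.
have [l l0 Kl] := step _ d0 xd dv.
have [] := step (- d).
- by rewrite oppr_eq0.
- by move=> k /xd; rewrite mxE => ->; rewrite oppr0.
- by move=> u; rewrite vsumN dv oppr0.
move=> m m0 Km.
have lm : 0 < l + m by rewrite addr_gt0.
have -> : x = (m / (l + m)) *: (x + l *: d) + (l / (l + m)) *: (x + m *: - d).
  by apply/rowP => k; rewrite !mxE; field; rewrite gt_eqF.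
by apply: coneD; apply: coneZ => //; rewrite divr_ge0 // ltW.
Qed.

End Bipartite.

(** * Degrees and matching counts under automorphisms *)

Definition edge_image (V : finType) (f : V -> V) (e : {set V}) : {set V} :=
  [set f u | u in e]%SET.

Lemma edge_image_inj (V : finType) (f : V -> V) :
  injective f -> injective (edge_image f).
Proof. by move=> f_inj e e'; exact: imset_inj. Qed.

Section Automorphisms.
Variables (V : finType) (E : {set {set V}}) (f : V -> V).
Hypothesis f_inj : injective f.
Hypothesis f_edge : forall e, e \in E -> edge_image f e \in E.

Lemma automorphism_matching M : perfect_matching E M ->
  perfect_matching E [set edge_image f e | e in M]%SET.
Proof.
case/and3P=> sME /finset.trivIsetP tM /eqP cM; apply/and3P; split.
- by apply/fintype.subsetP => _ /imsetP[e eM ->]; exact/f_edge/(fintype.subsetP sME).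
- apply/finset.trivIsetP => _ _ /imsetP[e eM ->] /imsetP[e' eM' ->] ee'.
  by rewrite imset_disjoint //; apply: tM => //; apply: contra ee' => /eqP ->.
- rewrite finset.eqEsubset finset.subsetT /=; apply/fintype.subsetP => u _.
  have [g gf fg] : bijective f by exact: injF_bij.
  have : g u \in finset.cover M by rewrite cM inE.
  case/finset.bigcupP=> e eM gue; apply/finset.bigcupP.
  exists (edge_image f e); first by apply/imsetP; exists e.
  by apply/imsetP; exists (g u); rewrite ?fg.
Qed.

Definition nmatch (e : {set V}) :=
  #|[set M : {set {set V}} | perfect_matching E M && (e \in M)]%SET|.

(** An inequality is enough: along a cycle of translations it closes up to an equality by
    [cyclic_monotone_const]. *)
Lemma nmatch_automorphism e : (nmatch e <= nmatch (edge_image f e))%N.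
Proof.
rewrite /nmatch -(card_imset _ (imset_inj (edge_image_inj f_inj))); apply: subset_leq_card.
apply/fintype.subsetP => _ /imsetP[M + ->]; rewrite !inE => /andP[pM eM].
by rewrite automorphism_matching //=; apply/imsetP; exists e.
Qed.

Definition degree (u : V) := #|[set e in E | u \in e]%SET|.

Lemma degree_automorphism u : (degree u <= degree (f u))%N.
Proof.
rewrite /degree -(card_imset _ (edge_image_inj f_inj)); apply: subset_leq_card.
apply/fintype.subsetP => _ /imsetP[e + ->]; rewrite !inE => /andP[eE ue].
by rewrite f_edge //=; apply/imsetP; exists u.
Qed.

End Automorphisms.

(** * Regular bipartite graphs *)

Section RegularBipartite.
Variables (R : realType) (V : finType) (E : {set {set V}}).

Lemma vsum_const1 u : vsum (const_mx 1 : 'rV[R]_#|E|) u = (degree E u)%:R.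
Proof.
rewrite /vsum; under eq_bigr => k _ do rewrite mxE mulr1.
rewrite -(big_enum_val (A := mem E) (fun e => (u \in e)%:R)) /=.
rewrite -natr_sum; congr _%:R; rewrite /degree -sum1_card.
rewrite big_mkcond [RHS]big_mkcond /=; apply: eq_bigr => e _.
by rewrite finset.in_set; case: (e \in E); case: (u \in e).
Qed.

Lemma comb1E (k : 'I_#|E|) : comb E (fun=> 1 : R) 0 k = (nmatch E (enum_val k))%:R.
Proof.
rewrite /comb summxE; under eq_bigr => M _ do rewrite scale1r mxE.
rewrite -natr_sum; congr _%:R; rewrite /nmatch -sum1_card.
rewrite big_mkcond [RHS]big_mkcond /=; apply: eq_bigr => M _.
by rewrite finset.in_set; case: (perfect_matching E M); case: (_ \in M).
Qed.

Lemma interior_ge1 (z : 'rV[int]_#|E|) :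
  icone (const_mx 1 : 'rV[R]_#|E|) -> icone (map_mx (intr : int -> R) z) ->
  forall k, 1 <= z 0 k.
Proof.
move=> I1 Iz k; have := @icone_gt0 _ _ _ _ _ k Iz (icone_cone I1).
by rewrite !mxE ltr01 => /(_ isT); rewrite ltr0z.
Qed.

(** Take [p] constant 1. Interior lattice points have all entries at least 1, so subtracting [p]
    leaves a nonnegative vector with constant vertex sums, and [bipartite_cone] applies. The vector
    [p] is interior by the same lemma, after removing a small multiple of the sum of all
    matchings. *)
Lemma regular_bipartite_Gorenstein (col : V -> bool) (r : nat) (u : V) :
  (0 < r)%N -> (forall e, e \in E -> bichromatic col e) ->
  (forall u, degree E u = r) -> Gorenstein (pm_polytope E R).
Proof.
move=> r0 Eb degr.
have bip (x : 'rV[R]_#|E|) s : (forall k, 0 <= x 0 k) ->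
    (forall u, vsum x u = s) -> cone x.
  move=> x0 xs; apply: (bipartite_cone x0 xs (col := col)) => k _.
  exact/Eb/enum_valP.
have toR1 : map_mx (intr : int -> R) (const_mx 1 : 'rV_#|E|) = const_mx 1.
  by apply/rowP => k; rewrite !mxE.
have I1 : icone (const_mx 1 : 'rV[R]_#|E|).
  have [e e0 He] : exists2 e : R, 0 < e & forall k, e * (nmatch E (enum_val (A := mem E) k))%:R <= 1.
    exists (#|{set {set V}}|.+1%:R^-1); first by rewrite invr_gt0.
    move=> k; rewrite mulrC ler_pdivrMr // mul1r ler_nat ltnW // ltnS.
    exact: max_card.
  apply: (icone_sub e0 (icone_comb1 R E)).
  apply: (bip _ (r%:R - e * mass E (fun=> 1))) => [k|u'].
    by rewrite !mxE comb1E subr_ge0 He.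
  by rewrite vsumB vsumZ vsum_comb vsum_const1 degr.
apply: (Gorenstein_intro (u := u) (p := const_mx 1) r0).
- by rewrite toR1.
- by rewrite toR1 vsum_const1 degr.
- move=> z Iz; rewrite map_mxB toR1.
  apply: (bip _ (vsum (map_mx intr z) u - r%:R)) => [k|u'].
    by rewrite !mxE subr_ge0 -[1]/(1%:~R) ler_int (interior_ge1 I1 Iz).
  by rewrite vsumB vsum_const1 degr; congr (_ - _); exact/cone_vsum/icone_cone.
Qed.

End RegularBipartite.

(** * Torus graphs in coordinates *)

(** Cyclic successor and predecessor on 0, ..., n - 1. For n = 1 both fix 0, and the corresponding
    edges shrink to singletons. *)
Definition nxt (n j : nat) : nat := if j.+1 == n then 0%N else j.+1.
Definition prv (n j : nat) : nat := if j == 0%N then n.-1 else j.-1.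

Lemma nxt_lt n j : (0 < n)%N -> (j < n)%N -> (nxt n j < n)%N.
Proof. by rewrite /nxt; case: eqP; lia. Qed.

Lemma prv_lt n j : (0 < n)%N -> (j < n)%N -> (prv n j < n)%N.
Proof. by rewrite /prv; case: eqP; lia. Qed.

Lemma prvK n j : (0 < n)%N -> (j < n)%N -> nxt n (prv n j) = j.
Proof. by rewrite /prv /nxt => n0 jn; case: (eqVneq j 0%N) => [->|j0]; case: eqP; lia. Qed.

Lemma nxtK n j : (0 < n)%N -> (j < n)%N -> prv n (nxt n j) = j.
Proof. by rewrite /prv /nxt => n0 jn; case: (eqVneq j.+1 n) => [<-|jn'] //=. Qed.

Lemma nxt_inj k i j : (0 < k)%N -> (i < k)%N -> (j < k)%N ->
  nxt k i = nxt k j -> i = j.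
Proof. by move=> k0 ik jk /(congr1 (prv k)); rewrite !nxtK. Qed.

Lemma nxt_neq k j : (1 < k)%N -> (j < k)%N -> nxt k j != j.
Proof. by rewrite /nxt => k1 jk; case: (eqVneq j.+1 k); lia. Qed.

(** Position [j] is an end of the cyclic edges starting at [j] and at [prv k j]; these starts
    differ, so the disjunction becomes a sum. *)
Lemma eq_prv k j l : (1 < k)%N -> (j < k)%N -> (l < k)%N ->
  ((j == l) || (j == nxt k l) : nat) = ((j == l) + (prv k j == l))%N.
Proof.
move=> k1 jk lk.
have -> : (j == nxt k l) = (prv k j == l).
  by apply/eqP/eqP => [->|<-]; rewrite ?nxtK ?prvK // ltnW.
case: eqP => [->|_]; last by case: (_ == l).
have /negbTE -> // : prv k l != l.
by rewrite /prv; case: (eqVneq l 0%N); lia.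
Qed.

(** Climbing from 0 to [j], and from [j] to n - 1 and round to 0, gives the two inequalities. *)
Lemma cyclic_monotone_const n (f : nat -> nat) : (0 < n)%N ->
  (forall j, (j < n)%N -> (f j <= f (nxt n j))%N) ->
  forall j, (j < n)%N -> f j = f 0%N.
Proof.
move=> n0 fle.
have up j : (j < n)%N -> (f 0%N <= f j)%N.
  elim: j => // j IH jn; have := fle j (ltnW jn).
  rewrite /nxt ltn_eqF //; apply: leq_trans; exact/IH/ltnW.
have down k : (k < n)%N -> (f (n.-1 - k)%N <= f 0%N)%N.
  elim: k => [|k IH] kn.
    have := fle n.-1; rewrite /nxt subn0 prednK // eqxx; exact.
  apply: leq_trans (IH (ltnW kn)).
  have := fle (n.-1 - k.+1)%N; rewrite /nxt ifF; last by apply/eqP; lia.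
  have -> : (n.-1 - k.+1).+1 = (n.-1 - k)%N by lia.
  by apply; lia.
move=> j jn; apply/eqP; rewrite eqn_leq up // andbT.
by have := down (n.-1 - j)%N; rewrite subKn; [apply; lia|lia].
Qed.

Section TorusEdges.
Variables (V : finType) (m n : nat) (v : nat -> nat -> V).

Definition hedge i j : {set V} := [set v i j; v i (nxt n j)]%SET.
Definition vedge i j : {set V} := [set v i j; v (nxt m i) j]%SET.

(* A torus graph through coordinates, so that the two factors can be interchanged. *)
Record torus_on (E : {set {set V}}) : Prop := TorusOn {
  torus_m_gt0 : (0 < m)%N;
  torus_n_gt0 : (0 < n)%N;
  torus_inj : forall i j k l, (i < m)%N -> (j < n)%N -> (k < m)%N -> (l < n)%N ->
    v i j = v k l -> i = k /\ j = l;
  torus_surj : forall u, exists i j, [/\ (i < m)%N, (j < n)%N & u = v i j];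
  torus_edgeP : forall e, e \in E <-> #|e| = 2%N /\
    exists i j, [/\ (i < m)%N, (j < n)%N & e = hedge i j \/ e = vedge i j] }.

Variables (E : {set {set V}}).
Hypothesis tE : torus_on E.
Let m0 := torus_m_gt0 tE.
Let n0 := torus_n_gt0 tE.

Lemma v_eq i j k l : (i < m)%N -> (j < n)%N -> (k < m)%N -> (l < n)%N ->
  (v i j == v k l) = (i == k) && (j == l).
Proof.
move=> im jn km ln; apply/eqP/andP => [/(torus_inj tE im jn km ln)[-> ->] //|].
by case=> /eqP -> /eqP ->.
Qed.

Lemma coordinates : {c : V -> nat * nat |
  forall u, [/\ ((c u).1 < m)%N, ((c u).2 < n)%N & v (c u).1 (c u).2 = u]}.
Proof.
apply: cid; have /choice[c Hc] : forall u, exists c : nat * nat,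
    [/\ (c.1 < m)%N, (c.2 < n)%N & v c.1 c.2 = u].
  by move=> u; have [i [j [im jn ->]]] := torus_surj tE u; exists (i, j).
by exists c.
Qed.

Definition cx u := (sval coordinates u).1.
Definition cy u := (sval coordinates u).2.

Lemma cxE i j : (i < m)%N -> (j < n)%N -> cx (v i j) = i.
Proof.
move=> im jn; rewrite /cx; case: coordinates => c /= /(_ (v i j))[h1 h2].
by move/(torus_inj tE h1 h2 im jn) => [].
Qed.

Lemma cyE i j : (i < m)%N -> (j < n)%N -> cy (v i j) = j.
Proof.
move=> im jn; rewrite /cy; case: coordinates => c /= /(_ (v i j))[h1 h2].
by move/(torus_inj tE h1 h2 im jn) => [].
Qed.

Definition shift1 u := v (nxt m (cx u)) (cy u).
Definition shift2 u := v (cx u) (nxt n (cy u)).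

Lemma shift1E i j : (i < m)%N -> (j < n)%N -> shift1 (v i j) = v (nxt m i) j.
Proof. by move=> im jn; rewrite /shift1 cxE // cyE. Qed.

Lemma shift2E i j : (i < m)%N -> (j < n)%N -> shift2 (v i j) = v i (nxt n j).
Proof. by move=> im jn; rewrite /shift2 cxE // cyE. Qed.

Lemma shift1_inj : injective shift1.
Proof.
move=> u u'; have [i [j [im jn ->]]] := torus_surj tE u.
have [k [l [km ln ->]]] := torus_surj tE u'; rewrite !shift1E //.
by move=> /(torus_inj tE (nxt_lt m0 im) jn (nxt_lt m0 km) ln)[/(nxt_inj m0 im km) -> ->].
Qed.

Lemma shift2_inj : injective shift2.
Proof.
move=> u u'; have [i [j [im jn ->]]] := torus_surj tE u.
have [k [l [km ln ->]]] := torus_surj tE u'; rewrite !shift2E //.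
by move=> /(torus_inj tE im (nxt_lt n0 jn) km (nxt_lt n0 ln))[-> /(nxt_inj n0 jn ln) ->].
Qed.

Lemma edge_image2 (f : V -> V) a b :
  edge_image f [set a; b]%SET = [set f a; f b]%SET.
Proof. by rewrite /edge_image imsetU !imset_set1. Qed.

Lemma shift1_hedge i j : (i < m)%N -> (j < n)%N ->
  edge_image shift1 (hedge i j) = hedge (nxt m i) j.
Proof. by move=> im jn; rewrite edge_image2 !shift1E // nxt_lt. Qed.

Lemma shift1_vedge i j : (i < m)%N -> (j < n)%N ->
  edge_image shift1 (vedge i j) = vedge (nxt m i) j.
Proof. by move=> im jn; rewrite edge_image2 !shift1E // nxt_lt. Qed.

Lemma shift2_hedge i j : (i < m)%N -> (j < n)%N ->
  edge_image shift2 (hedge i j) = hedge i (nxt n j).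
Proof. by move=> im jn; rewrite edge_image2 !shift2E // nxt_lt. Qed.

Lemma shift2_vedge i j : (i < m)%N -> (j < n)%N ->
  edge_image shift2 (vedge i j) = vedge i (nxt n j).
Proof. by move=> im jn; rewrite edge_image2 !shift2E // nxt_lt. Qed.

Lemma shift1_edge e : e \in E -> edge_image shift1 e \in E.
Proof.
case/(torus_edgeP tE) => e2 [i [j [im jn ee]]]; apply/(torus_edgeP tE).
split; first by rewrite card_imset //; exact: shift1_inj.
exists (nxt m i), j; rewrite nxt_lt //; split => //.
by case: ee => ->; [left; exact: shift1_hedge|right; exact: shift1_vedge].
Qed.

Lemma shift2_edge e : e \in E -> edge_image shift2 e \in E.
Proof.
case/(torus_edgeP tE) => e2 [i [j [im jn ee]]]; apply/(torus_edgeP tE).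
split; first by rewrite card_imset //; exact: shift2_inj.
exists i, (nxt n j); rewrite nxt_lt //; split => //.
by case: ee => ->; [left; exact: shift2_hedge|right; exact: shift2_vedge].
Qed.

Lemma torus_invariant (f : nat -> nat -> nat) :
  (forall i j, (i < m)%N -> (j < n)%N -> (f i j <= f (nxt m i) j)%N) ->
  (forall i j, (i < m)%N -> (j < n)%N -> (f i j <= f i (nxt n j))%N) ->
  forall i j, (i < m)%N -> (j < n)%N -> f i j = f 0%N 0%N.
Proof.
move=> f1 f2 i j im jn.
rewrite (@cyclic_monotone_const m (f^~ j)) // => [|k km]; last exact: f1.
by rewrite (@cyclic_monotone_const n (f 0%N)) // => k kn; exact: f2.
Qed.

Lemma torus_regular u : degree E u = degree E (v 0 0).
Proof.
have [i [j [im jn ->]]] := torus_surj tE u.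
apply: (@torus_invariant (fun i j => degree E (v i j))) => // {im jn} {}i {}j im jn.
  by rewrite -shift1E //; apply: degree_automorphism; [exact: shift1_inj|exact: shift1_edge].
by rewrite -shift2E //; apply: degree_automorphism; [exact: shift2_inj|exact: shift2_edge].
Qed.

Lemma nmatch_hedge i j : (i < m)%N -> (j < n)%N ->
  nmatch E (hedge i j) = nmatch E (hedge 0 0).
Proof.
apply: (@torus_invariant (fun i j => nmatch E (hedge i j))) => // {}i {}j im jn.
  by rewrite -shift1_hedge //; apply: nmatch_automorphism; [exact: shift1_inj|exact: shift1_edge].
by rewrite -shift2_hedge //; apply: nmatch_automorphism; [exact: shift2_inj|exact: shift2_edge].
Qed.

Lemma nmatch_vedge i j : (i < m)%N -> (j < n)%N ->
  nmatch E (vedge i j) = nmatch E (vedge 0 0).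
Proof.
apply: (@torus_invariant (fun i j => nmatch E (vedge i j))) => // {}i {}j im jn.
  by rewrite -shift1_vedge //; apply: nmatch_automorphism; [exact: shift1_inj|exact: shift1_edge].
by rewrite -shift2_vedge //; apply: nmatch_automorphism; [exact: shift2_inj|exact: shift2_edge].
Qed.

End TorusEdges.

(** * Edge vectors of the torus given by weights on index pairs *)

Lemma sum_delta (T : pzRingType) m n (i j : nat) (F : nat -> nat -> T) :
  (i < m)%N -> (j < n)%N ->
  \sum_(k < m) \sum_(l < n) ((i == k) && (j == l))%:R * F k l = F i j.
Proof.
move=> im jn; rewrite (bigD1 (Ordinal im)) //= (bigD1 (Ordinal jn)) //= !eqxx mul1r.
rewrite big1 => [|l lj]; last first.
  by rewrite -val_eqE /= eq_sym in lj; rewrite (negbTE lj) mul0r.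
rewrite big1 ?addr0 // => k ki; rewrite big1 // => l _.
by rewrite -val_eqE /= eq_sym in ki; rewrite (negbTE ki) mul0r.
Qed.

Section TorusVectors.
Variables (V : finType) (m n : nat) (v : nat -> nat -> V) (E : {set {set V}}).
Notation he := (hedge n v).
Notation ve := (vedge m v).

(* For m = 2 the edges [ve 0 j] and [ve 1 j] coincide and their weights add up. *)
Definition tvec (T : pzRingType) (h w : nat -> nat -> T) : 'rV[T]_#|E| :=
  \row_k \sum_(i < m) \sum_(j < n)
    ((enum_val k == he i j)%:R * h i j + (enum_val k == ve i j)%:R * w i j).

Lemma tvecD (T : pzRingType) (h w h' w' : nat -> nat -> T) :
  tvec h w + tvec h' w' =
  tvec (fun i j => h i j + h' i j) (fun i j => w i j + w' i j).
Proof.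
apply/rowP => k; rewrite !mxE -big_split; apply: eq_bigr => i _.
by rewrite -big_split; apply: eq_bigr => j _ /=; rewrite !mulrDr addrACA.
Qed.

Lemma tvecZ (T : comPzRingType) a (h w : nat -> nat -> T) :
  a *: tvec h w = tvec (fun i j => a * h i j) (fun i j => a * w i j).
Proof.
apply/rowP => k; rewrite !mxE mulr_sumr; apply: eq_bigr => i _.
by rewrite mulr_sumr; apply: eq_bigr => j _ /=; rewrite mulrDr !(mulrCA a).
Qed.

Lemma tvec_ext (T : pzRingType) (h w h' w' : nat -> nat -> T) :
  (forall i j, (i < m)%N -> (j < n)%N -> h i j = h' i j) ->
  (forall i j, (i < m)%N -> (j < n)%N -> w i j = w' i j) ->
  tvec h w = tvec h' w'.
Proof.
move=> hh ww; apply/rowP => k; rewrite !mxE; apply: eq_bigr => i _.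
by apply: eq_bigr => j _; rewrite hh // ww.
Qed.

Lemma tvec0 (T : pzRingType) : tvec (fun _ _ => 0 : T) (fun _ _ => 0) = 0.
Proof.
apply/rowP => k; rewrite !mxE big1 // => i _; rewrite big1 // => j _.
by rewrite !mulr0 addr0.
Qed.

Lemma tvec_sum (T : pzRingType) I (r : seq I) (h w : I -> nat -> nat -> T) :
  \sum_(a <- r) tvec (h a) (w a) =
  tvec (fun i j => \sum_(a <- r) h a i j) (fun i j => \sum_(a <- r) w a i j).
Proof.
elim: r => [|a r IH].
  rewrite big_nil -(tvec0 T); apply: tvec_ext => i j _ _; by rewrite big_nil.
rewrite big_cons IH tvecD; apply: tvec_ext => i j _ _; by rewrite big_cons.
Qed.

Lemma map_tvec (R : realType) (h w : nat -> nat -> int) :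
  map_mx (intr : int -> R) (tvec h w) =
  tvec (fun i j => (h i j)%:~R) (fun i j => (w i j)%:~R).
Proof.
apply/rowP => k; rewrite !mxE rmorph_sum; apply: eq_bigr => i _.
rewrite rmorph_sum; apply: eq_bigr => j _ /=.
by rewrite rmorphD !rmorphM /= !rmorph_nat.
Qed.

Lemma tvec_ge0 (T : numDomainType) (h w : nat -> nat -> T) k :
  (forall i j, (i < m)%N -> (j < n)%N -> 0 <= h i j) ->
  (forall i j, (i < m)%N -> (j < n)%N -> 0 <= w i j) -> 0 <= tvec h w 0 k.
Proof.
move=> h0 w0; rewrite mxE; do 2!apply: sumr_ge0 => ? _.
by rewrite addr_ge0 // mulr_ge0 // ?h0 ?w0.
Qed.

Lemma tvec_neq0 (T : pzRingType) (h w : nat -> nat -> T) k : tvec h w 0 k != 0 ->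
  exists i j, [/\ (i < m)%N, (j < n)%N &
    (enum_val k = he i j /\ h i j != 0) \/ (enum_val k = ve i j /\ w i j != 0)].
Proof.
move=> hk; apply: contrapT => nex; move/eqP: hk; apply.
rewrite mxE big1 // => i _; rewrite big1 // => j _.
have [kh|_] := eqVneq (enum_val k) (he i j); last first.
  rewrite mul0r add0r; have [kv|_] := eqVneq (enum_val k) (ve i j); last by rewrite mul0r.
  have [->|wij] := eqVneq (w i j) 0; first by rewrite mulr0.
  by case: nex; exists i, j; split => //; right.
have [->|hij] := eqVneq (h i j) 0; last first.
  by case: nex; exists i, j; split => //; left.
rewrite mulr0 add0r; have [kv|_] := eqVneq (enum_val k) (ve i j); last by rewrite mul0r.
have [->|wij] := eqVneq (w i j) 0; first by rewrite mulr0.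
by case: nex; exists i, j; split => //; right.
Qed.

Hypothesis tE : torus_on m n v E.
Hypothesis m_gt1 : (1 < m)%N.
Hypothesis n_gt2 : (2 < n)%N.
Let m0 : (0 < m)%N := ltnW m_gt1.
Let n1 : (1 < n)%N := ltnW n_gt2.
Let n0 : (0 < n)%N := ltnW n1.

Lemma in_hedge i j k l : (i < m)%N -> (j < n)%N -> (k < m)%N -> (l < n)%N ->
  (v i j \in he k l) = (i == k) && ((j == l) || (j == nxt n l)).
Proof.
move=> im jn km ln; rewrite !inE !(v_eq tE) ?nxt_lt //.
by case: (i == k).
Qed.

Lemma in_vedge i j k l : (i < m)%N -> (j < n)%N -> (k < m)%N -> (l < n)%N ->
  (v i j \in ve k l) = (j == l) && ((i == k) || (i == nxt m k)).
Proof.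
move=> im jn km ln; rewrite !inE !(v_eq tE) ?nxt_lt //.
by case: (j == l); rewrite ?andbF ?andbT.
Qed.

Lemma hedge_edge i j : (i < m)%N -> (j < n)%N -> he i j \in E.
Proof.
move=> im jn; apply/(torus_edgeP tE); split; last by exists i, j; split => //; left.
by rewrite cards2 (v_eq tE) ?nxt_lt // eqxx /= eq_sym nxt_neq.
Qed.

Lemma vedge_edge i j : (i < m)%N -> (j < n)%N -> ve i j \in E.
Proof.
move=> im jn; apply/(torus_edgeP tE); split; last by exists i, j; split => //; right.
by rewrite cards2 (v_eq tE) ?nxt_lt // eqxx andbT eq_sym nxt_neq.
Qed.

Lemma sum_edge (T : pzRingType) e (F : {set V} -> T) : e \in E ->
  \sum_(k < #|E|) (enum_val k == e)%:R * F (enum_val k) = F e.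
Proof.
move=> eE; rewrite -(big_enum_val (A := mem E) (fun f => (f == e)%:R * F f)) /=.
rewrite (bigD1 e) //= eqxx mul1r big1 ?addr0 // => f /andP[_ /negbTE ->].
by rewrite mul0r.
Qed.

Lemma vsum_tvec (R : realType) (h w : nat -> nat -> R) i j :
  (i < m)%N -> (j < n)%N ->
  vsum (tvec h w) (v i j) = h i j + h i (prv n j) + (w i j + w (prv m i) j).
Proof.
move=> im jn; rewrite /vsum.
under eq_bigr => k _ do rewrite mxE mulr_sumr.
rewrite exchange_big /=.
under eq_bigr => a _ do under eq_bigr => k _ do rewrite mulr_sumr.
under eq_bigr => a _ do rewrite exchange_big /=.
transitivity (\sum_(a < m) \sum_(b < n)
   ((v i j \in he a b)%:R * h a b + (v i j \in ve a b)%:R * w a b)).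
  apply: eq_bigr => a _; apply: eq_bigr => b _.
  under eq_bigr => k _ do rewrite mulrDr ![(v i j \in _)%:R * _]mulrCA.
  rewrite big_split /=.
  rewrite (sum_edge (fun e => (v i j \in e)%:R * h a b)) ?hedge_edge //.
  by rewrite (sum_edge (fun e => (v i j \in e)%:R * w a b)) ?vedge_edge.
have prvm : (prv m i < m)%N by exact: prv_lt.
have prvn : (prv n j < n)%N by exact: prv_lt.
rewrite -[h i j](@sum_delta _ m n i j h) // -[h i (prv n j)](@sum_delta _ m n _ _ h) //.
rewrite -[w i j](@sum_delta _ m n i j w) // -[w (prv m i) j](@sum_delta _ m n _ _ w) //.
rewrite -!big_split /=; apply: eq_bigr => a _; rewrite -!big_split /=.
apply: eq_bigr => b _; rewrite in_hedge // in_vedge // -!mulrDl -!natrD.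
congr (_%:R * _ + _%:R * _).
  by case: (i == a) => //=; exact: eq_prv.
case: (j == b); rewrite ?andbF ?andbT //=; exact: eq_prv.
Qed.

Lemma tvec_vsum_const (R : realType) (h w : nat -> nat -> R) s :
  (forall i j, (i < m)%N -> (j < n)%N ->
    h i j + h i (prv n j) + (w i j + w (prv m i) j) = s) ->
  forall u, vsum (tvec h w) u = s.
Proof.
move=> hs u; have [i [j [im jn ->]]] := torus_surj tE u.
by rewrite vsum_tvec // hs.
Qed.

Lemma hedge_eq i j k l : (i < m)%N -> (j < n)%N -> (k < m)%N -> (l < n)%N ->
  (he i j == he k l) = (i == k) && (j == l).
Proof.
move=> im jn km ln; apply/eqP/andP => [e|[/eqP -> /eqP ->] //].
have : v i j \in he k l by rewrite -e !inE eqxx.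
have : v i (nxt n j) \in he k l by rewrite -e !inE eqxx orbT.
rewrite !in_hedge ?nxt_lt // => /andP[/eqP -> h1] /andP[_ h2].
by split => //; move: h1 h2; rewrite /nxt; case: (eqVneq j.+1 n); case: (eqVneq l.+1 n); lia.
Qed.

Lemma hedge_neq_vedge i j k l : (i < m)%N -> (j < n)%N -> (k < m)%N -> (l < n)%N ->
  (he i j == ve k l) = false.
Proof.
move=> im jn km ln; apply/eqP => e.
have : v i j \in ve k l by rewrite -e !inE eqxx.
have : v i (nxt n j) \in ve k l by rewrite -e !inE eqxx orbT.
rewrite !in_vedge ?nxt_lt // => /andP[/eqP h1 _] /andP[/eqP h2 _].
by have := nxt_neq n1 jn; rewrite h1 h2 eqxx.
Qed.

Lemma vedge_eq i j k l : (i < m)%N -> (j < n)%N -> (k < m)%N -> (l < n)%N ->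
  (ve i j == ve k l) = ((i == k) || (m == 2%N)) && (j == l).
Proof.
move=> im jn km ln; apply/eqP/andP => [e|[/orP[/eqP ->|/eqP m2] /eqP -> //]].
  have : v i j \in ve k l by rewrite -e !inE eqxx.
  have : v (nxt m i) j \in ve k l by rewrite -e !inE eqxx orbT.
  rewrite !in_vedge ?nxt_lt // => /andP[/eqP -> h1] /andP[_ h2].
  by split => //; move: h1 h2; rewrite /nxt; case: (eqVneq i.+1 m); case: (eqVneq k.+1 m); lia.
have [->//|ik] := eqVneq i k; rewrite /vedge.
have -> : nxt m i = k by rewrite /nxt; case: eqP; lia.
have -> : nxt m k = i by rewrite /nxt; case: eqP; lia.
by rewrite finset.setUC.
Qed.

(** The weight per index pair that gives every vertical edge the value 1: for m = 2 each such edge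
    is counted by two pairs. *)
Definition vweight (R : realType) : R := if m == 2%N then 2^-1 else 1.

Lemma tvec_edges (R : realType) (f : {set V} -> R) :
  \row_k f (enum_val k) =
  tvec (fun i j => f (he i j)) (fun i j => vweight R * f (ve i j)).
Proof.
apply/rowP => k; rewrite !mxE; have := enum_valP k.
case/(torus_edgeP tE) => _ [i [j [im jn [ek|ek]]]].
  transitivity (\sum_(a < m) \sum_(b < n) ((i == a) && (j == b))%:R * f (he a b)).
    by rewrite (sum_delta (fun a b => f (he a b))) // ek.
  apply: eq_bigr => a _; apply: eq_bigr => b _.
  by rewrite ek hedge_eq // hedge_neq_vedge // mul0r addr0.
(* The second double sum is the contribution of the second index pair naming the same vertical edge,
   present only for m = 2. *)
transitivity (\sum_(a < m) \sum_(b < n) ((i == a) && (j == b))%:R *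
     (vweight R * f (ve a b)) +
   \sum_(a < m) \sum_(b < n) ((i == a) && (j == b))%:R *
     (if m == 2%N then vweight R * f (ve a b) else 0)).
  rewrite (sum_delta (fun a b => vweight R * f (ve a b))) //.
  rewrite (sum_delta (fun a b => if m == 2%N then vweight R * f (ve a b) else 0)) //.
  rewrite ek /vweight; case: (m == 2%N); last by rewrite mul1r addr0.
  by field.
have [m2|m2] := eqVneq m 2%N; last first.
  rewrite [X in _ + X]big1 => [|a _]; last first.
    by rewrite big1 // => b _; rewrite mulr0.
  rewrite addr0; apply: eq_bigr => a _; apply: eq_bigr => b _.
  by rewrite ek [ve i j == he _ _]eq_sym hedge_neq_vedge // mul0r add0r vedge_eq // (negbTE m2) orbF.
have im' : (nxt m i < m)%N by exact: nxt_lt.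
have sumE : \sum_(a < m) \sum_(b < n) ((i == a) && (j == b))%:R * (vweight R * f (ve a b))
   = \sum_(a < m) \sum_(b < n) ((nxt m i == a) && (j == b))%:R * (vweight R * f (ve a b)).
  rewrite !(sum_delta (fun a b => vweight R * f (ve a b))) //.
  by congr (_ * f _); apply/eqP; rewrite vedge_eq // m2 orbT eqxx.
rewrite [X in _ + X]sumE -big_split /=; apply: eq_bigr => a _.
rewrite -big_split; apply: eq_bigr => b _ /=.
rewrite ek [ve i j == he _ _]eq_sym hedge_neq_vedge // mul0r add0r vedge_eq // -mulrDl -natrD.
have -> : m == 2%N by rewrite m2.
congr (_%:R * _); rewrite orbT /=; case: (j == b); rewrite ?andbF ?andbT //=.
have am := ltn_ord a; rewrite /nxt; case: (eqVneq i.+1 m) => h1;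
  by do 2!case: eqP => ?; lia.
Qed.

End TorusVectors.

(** * Tori with an even and an odd side *)

(** No edge of [M] leaves [S], so the edges of [M] inside [S] partition it into pairs. *)
Lemma matching_inside_even (V : finType) (E : {set {set V}}) (M : {set {set V}})
    (S : {set V}) : perfect_matching E M -> (forall e, e \in E -> #|e| = 2%N) ->
  (forall e a b, e \in M -> a \in e -> b \in e -> (a \in S) = (b \in S)) ->
  ~~ odd #|S|.
Proof.
case/and3P=> sME tM /eqP cM E2 MS.
pose M' := [set e in M | e \subset S]%SET.
have <- : finset.cover M' = S.
  apply/setP => u; apply/finset.bigcupP/idP => [[e]|uS].
    by rewrite inE => /andP[_ /fintype.subsetP eS] /eS.
  have : u \in finset.cover M by rewrite cM inE.
  case/finset.bigcupP=> e eM ue; exists e => //; rewrite inE eM /=.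
  by apply/fintype.subsetP => a ae; rewrite (MS e a u).
have M'M : M' \subset M by apply/fintype.subsetP => e; rewrite inE => /andP[].
have /eqP <- := finset.trivIsetS M'M tM.
rewrite (eq_bigr (fun=> 2%N)) ?sum_nat_const; first by rewrite oddM andbF.
by move=> e /(fintype.subsetP M'M)/(fintype.subsetP sME)/E2.
Qed.

Section EvenOddTorus.
Variables (R : realType) (V : finType) (m n : nat) (v : nat -> nat -> V).
Variable E : {set {set V}}.
Hypothesis tE : torus_on m n v E.
Hypothesis m_gt1 : (1 < m)%N.
Hypothesis n_gt2 : (2 < n)%N.
Hypothesis m_even : ~~ odd m.
Hypothesis n_odd : odd n.
Notation he := (hedge n v).
Notation ve := (vedge m v).
Notation tv := (@tvec V m n v E R).
Implicit Types h w : nat -> nat -> R.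
Let m0 : (0 < m)%N := ltnW m_gt1.
Let n1 : (1 < n)%N := ltnW n_gt2.
Let n0 : (0 < n)%N := ltnW n1.

(* Deleting one horizontal edge [j0] in every row leaves a bipartite graph. *)
Lemma cut_cone j0 h w s : (j0 < n)%N ->
  (forall i j, (i < m)%N -> (j < n)%N -> 0 <= h i j) ->
  (forall i j, (i < m)%N -> (j < n)%N -> 0 <= w i j) ->
  (forall i, (i < m)%N -> h i j0 = 0) ->
  (forall i j, (i < m)%N -> (j < n)%N ->
    h i j + h i (prv n j) + (w i j + w (prv m i) j) = s) ->
  cone (tv h w).
Proof.
move=> j0n h0 w0 hj0 hs.
(* The last term changes between columns [j0] and [j0 + 1] and across the wrap-around edge. It
   corrects the chessboard colouring at the wrap-around, where odd n spoils it, and spoils it only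
   at the horizontal edges [j0], where [h] vanishes. *)
pose col u := odd (cx tE u + cy tE u + (cy tE u <= j0)%N).
apply: (@bipartite_cone _ _ _ col _ s) => [k||k /tvec_neq0[i [j [im jn]]]].
- exact: tvec_ge0.
- exact: tvec_vsum_const.
case=> -[ek hij].
  exists (v i j), (v i (nxt n j)); split => //.
  have jj0 : j != j0 by apply: contra hij => /eqP ->; rewrite hj0.
  rewrite /col !cxE ?cyE ?nxt_lt // /nxt.
  case: (eqVneq j.+1 n) => [jn'|_].
    have -> : (j <= j0)%N = false by apply: negbTE; clear -jj0 jn' j0n; lia.
    rewrite leq0n !addn0 addn1 /= oddD; move: n_odd; rewrite -jn' /=.
    by move=> /negbTE ->; case: (odd i).
  have -> : (j.+1 <= j0)%N = (j <= j0)%N.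
    by rewrite [RHS]leq_eqVlt (negbTE jj0).
  by rewrite addnS addSn /=; case: odd.
exists (v i j), (v (nxt m i) j); split => //.
rewrite /col !cxE ?cyE ?nxt_lt // /nxt.
case: (eqVneq i.+1 m) => [im'|_]; last by rewrite !addSn /=; case: odd.
rewrite add0n !oddD; move: m_even; rewrite -im' /= negbK => ->.
by case: (odd j); case: (j <= j0)%N.
Qed.

Lemma vertical_cone : cone (tv (fun _ _ => 0) (fun _ _ => 1)).
Proof.
by apply: (@cut_cone 0 _ _ (1 + 1)) => // i j _ _; rewrite !addr0 add0r.
Qed.

(** Sum over all columns [b] of the vector with 1 on the horizontal edges other than [b] and
    vertical weight 1/2 in the two columns that edge [b] joins, which restores the vertex sum 2. *)
Lemma horizontal_cone : cone (tv (fun _ _ => n.-1%:R) (fun _ _ => 1)).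
Proof.
pose hY (b : nat) (i j : nat) : R := (j != b)%:R.
pose wY (b : nat) (i j : nat) : R := ((j == b)%:R + (prv n j == b)%:R) / 2.
have delta1 j : (j < n)%N -> \sum_(b <- iota 0 n) (j == b)%:R = 1 :> R.
  move=> jn; rewrite (bigD1_seq j) ?mem_iota ?iota_uniq //= eqxx big1 ?addr0 //.
  by move=> b; rewrite eq_sym => /negbTE ->.
have natrN j b : (j != b)%:R = 1 - (j == b)%:R :> R.
  by case: (j == b); rewrite ?subr0 ?subrr.
have -> : tv (fun _ _ => n.-1%:R) (fun _ _ => 1) =
    \sum_(b <- iota 0 n) tv (hY b) (wY b).
  rewrite tvec_sum; apply: tvec_ext => i j im jn.
    under eq_bigr => b _ do rewrite /hY natrN.
    rewrite sumrB delta1 // big_const_seq count_predT size_iota.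
    by rewrite iter_addr addr0 -[X in _ - X]/(1%:R) -natrB // subn1.
  rewrite -mulr_suml big_split /= !delta1 ?prv_lt //.
  by field.
rewrite big_seq; apply: cone_sum => b; rewrite mem_iota => /andP[_ bn].
apply: (@cut_cone b _ _ (1 + 1)) => //.
- by move=> i j _ _; rewrite divr_ge0 ?addr_ge0 ?ler0n.
- by move=> i _; rewrite /hY eqxx.
- move=> i j im jn; rewrite /hY /wY.
  by case: (j == b); case: (prv n j == b) => /=; field.
Qed.

Lemma sym_cone a b : 0 <= a -> a <= n.-1%:R * b ->
  cone (tv (fun _ _ => a) (fun _ _ => b)).
Proof.
move=> a0 ab; have n10 : 0 < n.-1%:R :> R by rewrite ltr0n; lia.
have -> : tv (fun _ _ => a) (fun _ _ => b) =
    (a / n.-1%:R) *: tv (fun _ _ => n.-1%:R) (fun _ _ => 1) +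
    (b - a / n.-1%:R) *: tv (fun _ _ => 0) (fun _ _ => 1).
  rewrite !tvecZ tvecD; apply: tvec_ext => i j _ _.
    by rewrite mulr0 addr0 divfK // gt_eqF.
  by rewrite !mulr1 addrC subrK.
apply: coneD; apply: coneZ.
- by rewrite divr_ge0 // ltW.
- exact: horizontal_cone.
- by rewrite subr_ge0 ler_pdivrMr // mulrC.
- exact: vertical_cone.
Qed.

(** Translations permute the perfect matchings, so the number of matchings through an edge depends
    only on its direction. *)
Lemma comb1_sym : exists p q : R, [/\ 0 <= p, 0 <= q &
  comb E (fun=> 1) = tv (fun _ _ => p) (fun _ _ => q)].
Proof.
exists (nmatch E (he 0 0))%:R, (vweight m R * (nmatch E (ve 0 0))%:R); split.
- exact: ler0n.
- by rewrite mulr_ge0 ?ler0n // /vweight; case: ifP => _; rewrite ?invr_ge0 ?ler0n ?ler01.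
have -> : comb E (fun=> 1) = \row_k (nmatch E (enum_val k))%:R :> 'rV[R]_#|E|.
  by apply/rowP => k; rewrite comb1E mxE.
rewrite (tvec_edges tE m_gt1 n_gt2 (fun e => (nmatch E e)%:R)).
apply: tvec_ext => i j im jn.
  by rewrite (nmatch_hedge tE).
by rewrite (nmatch_vedge tE).
Qed.

(** The sum of all matchings has the same two-valued form, and the strict inequalities leave room to
    remove a small multiple of it within the bounds of [sym_cone]. *)
Lemma sym_icone a b : 0 < a -> a < n.-1%:R * b ->
  icone (tv (fun _ _ => a) (fun _ _ => b)).
Proof.
move=> a0 ab; have n10 : 0 < n.-1%:R :> R by rewrite ltr0n; lia.
have [p [q [p0 q0 pq]]] := comb1_sym.
pose c := n.-1%:R * b - a.
have c0 : 0 < c by rewrite subr_gt0.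
(* The two terms bound the two ratios that limit the multiple [e]. *)
pose S := p / a + n.-1%:R * q / c.
have S0 : 0 < 1 + S.
  rewrite ltr_pwDl // addr_ge0 // divr_ge0 //; do ?[exact: ltW].
  by rewrite mulr_ge0 // ltW.
pose e := (1 + S)^-1; have e0 : 0 < e by rewrite invr_gt0.
have ep : e * p <= a.
  rewrite mulrC ler_pdivrMr // mulrC -ler_pdivrMr // /S addrCA lerDl.
  by rewrite addr_ge0 // divr_ge0 ?mulr_ge0 // ltW.
have eq : e * (n.-1%:R * q) <= c.
  rewrite mulrC ler_pdivrMr // [c * _]mulrC -ler_pdivrMr // /S addrA lerDr.
  by rewrite addr_ge0 // divr_ge0 // ltW.
apply: (icone_sub e0 (icone_comb1 R E)).
rewrite pq -scaleNr tvecZ tvecD; apply: sym_cone.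
  by rewrite mulNr subr_ge0.
rewrite mulNr; rewrite /c in eq; nra.
Qed.

Lemma const1_tvec : const_mx 1 = tv (fun _ _ => 1) (fun _ _ => vweight m R).
Proof.
have -> : const_mx 1 = \row_k (fun _ : {set V} => 1 : R) (enum_val (A := mem E) k).
  by apply/rowP => k; rewrite !mxE.
by rewrite (tvec_edges tE m_gt1 n_gt2 (fun=> 1)); apply: tvec_ext => i j _ _ //; rewrite mulr1.
Qed.

(** A positive vertex sum forces a matching with nonzero coefficient. Its edges lie in the support,
    hence do not leave [S], which contradicts the parity of [S]. *)
Lemma odd_component_not_cone (S : {set V}) h w (u : V) : odd #|S| ->
  (forall i j, (i < m)%N -> (j < n)%N -> h i j != 0 ->
    (v i j \in S) = (v i (nxt n j) \in S)) ->
  (forall i j, (i < m)%N -> (j < n)%N -> w i j != 0 ->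
    (v i j \in S) = (v (nxt m i) j \in S)) ->
  0 < vsum (tv h w) u -> ~ cone (tv h w).
Proof.
move=> oS hS wS y0 [c c0 yc].
have [M [pM cM]] : exists M, perfect_matching E M /\ c M != 0.
  apply: contrapT => /forallNP nM; move: y0; rewrite yc vsum_comb /mass big1 ?ltxx //.
  move=> M pM; apply/eqP; apply: contrapT => /negP cM; exact: (nM M).
have : ~~ odd #|S|; last by rewrite oS.
apply: (matching_inside_even pM) => [e /(torus_edgeP tE)[] //|e a b eM ae be].
have eE : e \in E by have /and3P[/fintype.subsetP + _ _] := pM; apply.
pose k := enum_rank_in eE e.
have ek : enum_val k = e by rewrite enum_rankK_in.
have : tv h w 0 k != 0.
  rewrite yc /comb summxE gt_eqF // (bigD1 M) //= ltr_pwDl //.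
    by rewrite !mxE ek eM mulr1 lt_neqAle eq_sym cM c0.
  by apply: sumr_ge0 => M' _; rewrite !mxE mulr_ge0.
case/tvec_neq0 => i [j [im jn]]; rewrite ek => -[[ee hij]|[ee wij]].
  by move: ae be; rewrite ee !inE => /orP[]/eqP -> /orP[]/eqP ->; rewrite ?(hS i j im jn hij).
by move: ae be; rewrite ee !inE => /orP[]/eqP -> /orP[]/eqP ->; rewrite ?(wS i j im jn wij).
Qed.

Definition zero_row : {set V} := [set v 0 j | j : 'I_n]%SET.

Lemma in_zero_row i j : (i < m)%N -> (j < n)%N -> (v i j \in zero_row) = (i == 0%N).
Proof.
move=> im jn; apply/imsetP/eqP => [[k _ /(torus_inj tE)[]] //|->].
by exists (Ordinal jn).
Qed.

Lemma zero_row_odd : odd #|zero_row|.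
Proof.
rewrite card_imset ?card_ord // => j k /(torus_inj tE)[] // _.
exact: val_inj.
Qed.

Lemma torus_degree_gt0 : (0 < degree E (v 0 0))%N.
Proof.
apply/card_gt0P; exists (he 0 0); rewrite inE (hedge_edge tE) //=.
by rewrite !inE eqxx.
Qed.

(** Here [p] is the all-ones vector, of least vertex sum because interior lattice points are at
    least 1 everywhere, and [w = 1 + y]. *)
Lemma not_Gorenstein_from_const1 (y : 'rV[int]_#|E|) :
  let y' := map_mx (intr : int -> R) y in
  icone (const_mx 1 : 'rV[R]_#|E|) -> icone (const_mx 1 + y') -> ~ cone y' ->
  ~ Gorenstein (pm_polytope E R).
Proof.
move=> y' I1 Iy nK.
have toR1 : map_mx (intr : int -> R) (const_mx 1 : 'rV_#|E|) = const_mx 1.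
  by apply/rowP => k; rewrite !mxE.
apply: (@not_Gorenstein _ _ _ (v 0 0) (const_mx 1) (const_mx 1 + y) _ torus_degree_gt0).
- by rewrite toR1.
- by rewrite toR1 vsum_const1.
- move=> z Iz; rewrite -vsum_const1 -subr_ge0 -vsumB; apply: sumr_ge0 => k _.
  rewrite mulr_ge0 ?ler0n // !mxE subr_ge0 -[1]/(1%:~R) ler_int.
  exact: (interior_ge1 I1 Iz).
- by rewrite map_mxD toR1.
- by rewrite addrAC subrr add0r.
Qed.

(** The vector [y] is 1 on horizontal and 0 on vertical edges; its components are the rows, of odd
    size n. The hypothesis is the condition of [sym_icone] for [1 + y], which has horizontal weight
    2. *)
Lemma not_Gorenstein_rows : 2 < n.-1%:R * vweight m R ->
  ~ Gorenstein (pm_polytope E R).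
Proof.
move=> h2.
apply: (@not_Gorenstein_from_const1 (tvec m n v E (fun _ _ => 1) (fun _ _ => 0))).
- by rewrite const1_tvec; apply: sym_icone => //; apply: le_lt_trans h2; rewrite ler1n.
- rewrite map_tvec const1_tvec tvecD.
  rewrite [X in icone X](_ : _ = tv (fun _ _ => 2) (fun _ _ => vweight m R)).
    by apply: sym_icone.
  by apply: tvec_ext => i j _ _; rewrite ?addr0.
- rewrite map_tvec; apply: (@odd_component_not_cone zero_row _ _ (v 0 0) zero_row_odd).
  + by move=> i j im jn _; rewrite !in_zero_row // nxt_lt.
  + by move=> i j im jn; rewrite eqxx.
  + by rewrite (vsum_tvec tE) //= mulr1z mulr0z; lra.
Qed.

End EvenOddTorus.

(** * Three columns *)

Section ThreeColumns.
Local Open Scope nat_scope.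

(* [yh], [yw] describe the 2-factor formed by two 5-cycles in rows 0, 1 and 2, 3, the
   doubled edge joining (1,1) to (2,1), and doubled vertical edges in the other rows.
   Adding 1/2 to every entry and multiplying by 4 gives the sum of the vector
   [xh], [xw], which avoids the horizontal edge 0, and of its mirror image. *)
Definition yh (i j : nat) : nat :=
  match i with
  | 0 | 3 => nth 0 [:: 1; 1; 0] j
  | 1 | 2 => nth 0 [:: 0; 0; 1] j
  | _ => 0
  end.

Definition yw (i j : nat) : nat :=
  match i with
  | 0 | 2 => nth 0 [:: 1; 0; 1] j
  | 1 => nth 0 [:: 0; 2; 0] j
  | _ => if odd i then 0 else 2
  end.

Definition xh (i j : nat) : nat :=
  match i with
  | 0 | 3 => nth 0 [:: 0; 6; 1] j
  | 1 | 2 => nth 0 [:: 0; 2; 3] j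
  | _ => nth 0 [:: 0; 2; 1] j
  end.

Definition xw (i j : nat) : nat :=
  match i with
  | 0 | 2 => nth 0 [:: 5; 1; 1] j
  | 1 => nth 0 [:: 0; 5; 2] j
  | _ => if odd i then nth 0 [:: 2; 1; 0] j else 5
  end.

(** Reflecting column j to 2 - j exchanges the horizontal edges 0 and 1 and fixes 2, whereas among
    vertical edges it exchanges columns 0 and 2. *)
Definition xh' (i j : nat) : nat := xh i (nth 0 [:: 1; 0; 2] j).
Definition xw' (i j : nat) : nat := xw i (nth 0 [:: 2; 1; 0] j).

Lemma x_sum m i j : 3 < m -> ~~ odd m -> i < m -> j < 3 ->
  xh i j + xh i (prv 3 j) + (xw i j + xw (prv m i) j) = 8.
Proof.
case: m => [|[|[|[|m]]]] // _ /=; rewrite !negbK => om im.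
case: i im => [|[|[|[|i]]]] _; case: j => [|[|[|]]] // _;
  rewrite /prv /= ?negbK ?(negbTE om) //=; by case: (odd i).
Qed.

Lemma x'_sum m i j : 3 < m -> ~~ odd m -> i < m -> j < 3 ->
  xh' i j + xh' i (prv 3 j) + (xw' i j + xw' (prv m i) j) = 8.
Proof.
case: m => [|[|[|[|m]]]] // _ /=; rewrite !negbK => om im.
case: i im => [|[|[|[|i]]]] _; case: j => [|[|[|]]] // _;
  rewrite /xh' /xw' /prv /= ?negbK ?(negbTE om) //=; by case: (odd i).
Qed.

Lemma xh_y i j : j < 3 -> xh i j + xh' i j = 4 * yh i j + 2.
Proof. by case: i => [|[|[|[|i]]]]; case: j => [|[|[|]]]. Qed.

Lemma xw_y i j : j < 3 -> xw i j + xw' i j = 4 * yw i j + 2.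
Proof.
case: i => [|[|[|i]]]; case: j => [|[|[|]]] //; rewrite /xw' /xw /yw /=;
  by case: (odd i).
Qed.

End ThreeColumns.

Section EvenByThree.
Variables (R : realType) (V : finType) (m : nat) (v : nat -> nat -> V).
Variable E : {set {set V}}.
Hypothesis tE : torus_on m 3 v E.
Hypothesis m_gt3 : (3 < m)%N.
Hypothesis m_even : ~~ odd m.
Let m_gt1 : (1 < m)%N := ltnW (ltnW m_gt3).
Notation tv := (@tvec V m 3 v E R).

Lemma vweight1 : vweight m R = 1.
Proof. by rewrite /vweight ifF //; apply/eqP; lia. Qed.

(** The vertices of the 5-cycle in rows 0 and 1; (1,1) is missing, being joined to (2,1) in the
    support of [y]. *)
Definition five_cycle : {set V} :=
  (v 0 0 |: (v 0 1 |: (v 0 2 |: [set v 1 0; v 1 2])))%SET.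

Lemma five_cycle_odd : odd #|five_cycle|.
Proof.
have m0 : (0 < m)%N by lia.
by rewrite /five_cycle !cardsU1 cards1 !inE !(v_eq tE).
Qed.

Lemma in_five_cycle i j : (i < m)%N -> (j < 3)%N ->
  (v i j \in five_cycle) = (i == 0%N) || ((i == 1%N) && (j != 1%N)).
Proof.
have m0 : (0 < m)%N by lia.
move=> im j3; rewrite !inE !(v_eq tE) //.
by case: i im => [|[|i]] im; case: j j3 => [|[|[|j]]].
Qed.

Lemma not_Gorenstein_three : ~ Gorenstein (pm_polytope E R).
Proof.
have m0 : (0 < m)%N by lia.
have I1 : icone (const_mx 1 : 'rV[R]_#|E|).
  by rewrite (const1_tvec _ tE) // vweight1; apply: (sym_icone tE) => //; rewrite mulr1 ltr1n.
pose y := tvec m 3 v E (fun i j => (yh i j)%:Z) (fun i j => (yw i j)%:Z).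
apply: (@not_Gorenstein_from_const1 _ _ _ _ _ _ tE _ _ y) => //.
  (* Removing half of the all-ones vector from [1 + y] leaves [y] plus 1/2 everywhere, a quarter of
     the sum of the two explicit vectors. [cut_cone] applies to these at the horizontal edges 0 and
     1 respectively. *)
  apply: (@icone_sub _ _ _ 2^-1 _ _ _ I1); first by rewrite invr_gt0.
  have -> : const_mx 1 + map_mx intr y - 2^-1 *: const_mx 1 =
    4^-1 *: tv (fun i j => (xh i j)%:R) (fun i j => (xw i j)%:R) +
    4^-1 *: tv (fun i j => (xh' i j)%:R) (fun i j => (xw' i j)%:R).
    rewrite -scalerDr tvecD map_tvec (const1_tvec _ tE) // vweight1 -scaleNr !tvecZ !tvecD.
    apply: tvec_ext => i j im j3; rewrite -natrD ?xh_y ?xw_y // natrD natrM.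
      by rewrite -[(yh i j)%:~R]/((yh i j)%:R); field.
    by rewrite -[(yw i j)%:~R]/((yw i j)%:R); field.
  apply: coneD; apply: coneZ; rewrite ?invr_ge0 ?ler0n //.
    apply: (cut_cone tE m_gt1 _ _ _ (j0 := 0) (s := 8)) => // i.
    - by move=> _; case: i => [|[|[|[|i]]]].
    - by move=> j im j3; rewrite -!natrD x_sum.
  apply: (cut_cone tE m_gt1 _ _ _ (j0 := 1) (s := 8)) => // i.
  - by move=> _; case: i => [|[|[|[|i]]]].
  - by move=> j im j3; rewrite -!natrD x'_sum.
rewrite map_tvec; apply: (odd_component_not_cone tE (S := five_cycle) (u := v 0 0)) => //.
- exact: five_cycle_odd.
- move=> i j im j3; rewrite intr_eq0 => yij; rewrite !in_five_cycle ?nxt_lt //.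
  by case: i im yij => [|[|i]] im; case: j j3 => [|[|[|j]]].
- move=> i j im j3; rewrite intr_eq0 => yij; rewrite !in_five_cycle ?nxt_lt //.
  case: i im yij => [|[|[|i]]] im.
  + have -> : nxt m 0 = 1%N by rewrite /nxt ifF //; apply/eqP; lia.
    by case: j j3 => [|[|[|j]]].
  + have -> : nxt m 1 = 2%N by rewrite /nxt ifF //; apply/eqP; lia.
    by case: j j3 => [|[|[|j]]].
  + have -> // : nxt m 2 = 3%N by rewrite /nxt ifF //; apply/eqP; lia.
  (* Only the wrap-around edge could reach row 0; it starts in row m - 1, which is odd, where [yw]
     vanishes. *)
  + have [mi|mi] := eqVneq i.+4 m; last by rewrite /nxt (negbTE mi).
    by move: m_even; rewrite -mi /= !negbK => /negbTE oi; rewrite /yw /= oi eqxx.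
- by rewrite (vsum_tvec tE) //; rewrite -!rmorphD ltr0z.
Qed.

End EvenByThree.

(** * Prisms *)

Section Prism.
Variables (R : realType) (V : finType) (n : nat) (v : nat -> nat -> V).
Variable E : {set {set V}}.
Hypothesis tE : torus_on 2 n v E.
Hypothesis n_gt2 : (2 < n)%N.
Hypothesis n_odd : odd n.
Notation he := (hedge n v).
Notation ve := (vedge 2 v).
Notation tv := (@tvec V 2 n v E R).
Implicit Types (a : nat -> R) (x y : 'rV[R]_#|E|).
Let n1 : (1 < n)%N := ltnW n_gt2.
Let n0 : (0 < n)%N := ltnW n1.

(** Equal values [a] on both cycles and vertex sum [s]: rung [j] carries [s - a j - a (prv n j)],
    halved because two index pairs name it. *)
Definition prism a (s : R) : 'rV[R]_#|E| :=
  tv (fun _ j => a j) (fun _ j => (s - a j - a (prv n j)) / 2).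

Lemma prismD a b s t : prism a s + prism b t = prism (fun j => a j + b j) (s + t).
Proof. by rewrite tvecD; apply: tvec_ext => i j _ _ //; field. Qed.

Lemma prismB a b s t : prism a s - prism b t = prism (fun j => a j - b j) (s - t).
Proof. by rewrite -scaleN1r tvecZ tvecD; apply: tvec_ext => i j _ _; field. Qed.

Lemma prism_ext a b s t : (forall j, (j < n)%N -> a j = b j) -> s = t ->
  prism a s = prism b t.
Proof.
move=> ab ->; apply: tvec_ext => i j _ jn; first exact: ab.
by rewrite !ab // prv_lt.
Qed.

Lemma vsum_prism a s u : vsum (prism a s) u = s.
Proof. by apply: (tvec_vsum_const tE) => // i j _ _; field. Qed.

Lemma prism_cut a s j0 : (j0 < n)%N -> a j0 = 0 ->
  (forall j, (j < n)%N -> 0 <= a j) ->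
  (forall j, (j < n)%N -> a j + a (prv n j) <= s) -> cone (prism a s).
Proof.
move=> j0n aj0 a0 as_; apply: (cut_cone tE _ n_gt2 _ n_odd (j0 := j0) (s := s)) => //.
- by move=> i j _; exact: a0.
- by move=> i j _ jn; rewrite divr_ge0 ?ler0n // -addrA -opprD subr_ge0 as_.
- by move=> i j _ _; field.
Qed.

(** The coordinate at an edge given as a set of vertices, and 0 at a set that is not an edge. *)
Definition edge_val (T : pzRingType) (x : 'rV[T]_#|E|) (e : {set V}) : T :=
  \sum_(k < #|E|) (enum_val k == e)%:R * x 0 k.

Lemma edge_val_enum (T : pzRingType) (x : 'rV[T]_#|E|) k :
  edge_val x (enum_val k) = x 0 k.
Proof.
rewrite /edge_val (bigD1 k) //= eqxx mul1r big1 ?addr0 // => l lk.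
by rewrite (inj_eq enum_val_inj) (negbTE lk) mul0r.
Qed.

Lemma edge_val_gt0 x e : e \in E -> (forall k, 0 < x 0 k) -> 0 < edge_val x e.
Proof.
by move=> eE x0; rewrite -(enum_rankK_in eE eE) edge_val_enum.
Qed.

Lemma tvec_gt0 (h w : nat -> nat -> R) k :
  (forall i j, (i < 2)%N -> (j < n)%N -> 0 < h i j) ->
  (forall i j, (i < 2)%N -> (j < n)%N -> 0 < w i j) -> 0 < tv h w 0 k.
Proof.
move=> h0 w0; have := enum_valP k.
case/(torus_edgeP tE) => _ [i [j [i2 jn ek]]].
have term_ge0 (a : 'I_2) (b : 'I_n) :
    0 <= (enum_val k == he a b)%:R * h a b + (enum_val k == ve a b)%:R * w a b.
  by rewrite addr_ge0 // mulr_ge0 ?ler0n // ltW ?h0 ?w0.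
rewrite mxE (bigD1 (Ordinal i2)) //= (bigD1 (Ordinal jn)) //= -addrA ltr_pwDl //.
  case: ek => ->; rewrite eqxx mul1r.
    by rewrite ltr_pwDl ?h0 // mulr_ge0 ?ler0n // ltW ?w0.
  by rewrite ltr_wpDl ?w0 // mulr_ge0 ?ler0n // ltW ?h0.
rewrite addr_ge0 //; first by apply: sumr_ge0 => b _; exact: (term_ge0 (Ordinal i2)).
by apply: sumr_ge0 => a _; apply: sumr_ge0 => b _; exact: term_ge0.
Qed.

Lemma edge_valD x y e : edge_val (x + y) e = edge_val x e + edge_val y e.
Proof. by rewrite -big_split; apply: eq_bigr => k _; rewrite mxE mulrDr. Qed.

Lemma edge_valZ c x e : edge_val (c *: x) e = c * edge_val x e.
Proof. by rewrite mulr_sumr; apply: eq_bigr => k _; rewrite mxE mulrCA. Qed.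

Lemma edge_val_toR (z : 'rV[int]_#|E|) e :
  edge_val (map_mx (intr : int -> R) z) e = (edge_val z e)%:~R.
Proof.
rewrite rmorph_sum; apply: eq_bigr => k _.
by rewrite mxE rmorphM /= rmorph_nat.
Qed.

(** Every perfect matching uses a rung, since a row has an odd number of vertices. This is the odd
    cut inequality of the row. *)
Lemma rung_sum_ge x u : cone x -> vsum x u <= \sum_(j < n) edge_val x (ve 0 j).
Proof.
case=> c c0 ->; rewrite vsum_comb /mass.
have -> : \sum_(j < n) edge_val (comb E c) (ve 0 j) =
    \sum_(M | perfect_matching E M) c M * \sum_(j < n) (ve 0 j \in M)%:R.
  under [RHS]eq_bigr => M _ do rewrite mulr_sumr.
  rewrite [RHS]exchange_big /=; apply: eq_bigr => j _.
  have jE : ve 0 j \in E by exact: (vedge_edge tE).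
  rewrite -[in LHS](enum_rankK_in jE jE) edge_val_enum summxE.
  by apply: eq_bigr => M _; rewrite !mxE enum_rankK_in.
apply: ler_sum => M pM; rewrite ler_peMr // -natr_sum ler1n lt0n.
apply/negP; rewrite sum_nat_eq0 => /forallP nM.
have veM i j : (i < 2)%N -> (j < n)%N -> ve i j \notin M.
  move=> i2 jn; have := nM (Ordinal jn); rewrite /= eqb0.
  suff -> : ve i j = ve 0 j by [].
  by apply/eqP; rewrite (vedge_eq tE) // !eqxx orbT.
have : ~~ odd #|zero_row n v|; last by rewrite (zero_row_odd tE).
apply: (matching_inside_even pM) => [e /(torus_edgeP tE)[] //|e b d eM].
have eE : e \in E by have /and3P[/fintype.subsetP + _ _] := pM; apply.
have [_ [i [j [i2 jn [ee|ee]]]]] := (torus_edgeP tE e).1 eE.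
  by rewrite ee !inE => /orP[]/eqP -> /orP[]/eqP ->; rewrite !(in_zero_row tE) ?nxt_lt.
by have := veM i j i2 jn; rewrite -ee eM.
Qed.

Lemma edge_val_tvec_rung (h w : nat -> nat -> R) j : (j < n)%N ->
  edge_val (tv h w) (ve 0 j) = w 0%N j + w 1%N j.
Proof.
move=> jn; have jE : ve 0 j \in E by exact: (vedge_edge tE).
rewrite -(enum_rankK_in jE jE) edge_val_enum mxE enum_rankK_in //.
have delta i : (i < 2)%N -> \sum_(l < n) ((ve 0 j == he i l)%:R * h i l +
    (ve 0 j == ve i l)%:R * w i l) = w i j.
  move=> i2; rewrite (bigD1 (Ordinal jn)) //= big1 => [|l lj].
    rewrite [_ == he _ _]eq_sym (hedge_neq_vedge tE) // (vedge_eq tE) // !eqxx orbT /=.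
    by rewrite mul0r mul1r add0r addr0.
  rewrite [_ == he _ _]eq_sym (hedge_neq_vedge tE) // (vedge_eq tE) // orbT /=.
  by rewrite -val_eqE /= eq_sym in lj; rewrite (negbTE lj) !mul0r addr0.
by rewrite !big_ord_recl big_ord0 addr0 !delta.
Qed.

(** An interior point stays in the cone after removal of a small multiple of a vector for which
    [rung_sum_ge] is strict; adding it back gives strictness. *)
Lemma rung_sum_gt a s x u : icone x -> cone (prism a s) ->
  s < \sum_(j < n) (s - a j - a (prv n j)) ->
  vsum x u < \sum_(j < n) edge_val x (ve 0 j).
Proof.
move=> Ix Kp sp; have [e e0 Ke] := icone_subP Ix Kp.
have := rung_sum_ge u Ke; rewrite vsumB vsumZ vsum_prism.
have -> : \sum_(j < n) edge_val (x - e *: prism a s) (ve 0 j) =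
    \sum_(j < n) edge_val x (ve 0 j) - e * \sum_(j < n) (s - a j - a (prv n j)).
  rewrite mulr_sumr -sumrB; apply: eq_bigr => j _.
  by rewrite edge_valD -scaleNr edge_valZ edge_val_tvec_rung //; field.
have := sp; rewrite -(ltr_pM2l e0); lra.
Qed.

Lemma vsum_edges x i j : (i < 2)%N -> (j < n)%N ->
  vsum x (v i j) = edge_val x (he i j) + edge_val x (he i (prv n j)) +
    edge_val x (ve 0 j).
Proof.
move=> i2 jn.
have xE : x = \row_k edge_val x (enum_val k).
  by apply/rowP => k; rewrite mxE edge_val_enum.
rewrite [in LHS]xE (tvec_edges tE) // (vsum_tvec tE) //; congr (_ + _).
have veE k : (k < 2)%N -> ve k j = ve 0 j.
  by move=> k2; apply/eqP; rewrite (vedge_eq tE) // !eqxx orbT.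
by rewrite !veE ?prv_lt // /vweight eqxx; field.
Qed.

(** Equal vertex sums at the two ends of a rung make the difference [d] of the two cycles change
    sign at each step; round an odd cycle it must vanish. *)
Lemma cone_prism x u : cone x ->
  x = prism (fun j => edge_val x (he 0 j)) (vsum x u).
Proof.
move=> Kx; pose d j := edge_val x (he 0 j) - edge_val x (he 1 j).
have dprv j : (j < n)%N -> d j + d (prv n j) = 0.
  move=> jn; have := cone_vsum (v 0 j) (v 1 j) Kx.
  by rewrite !vsum_edges // /d; lra.
have dsign j : (j < n)%N -> d j = (-1) ^+ j * d 0%N.
  elim: j => [_|j IH jn]; first by rewrite mul1r.
  have := dprv _ jn; rewrite /prv /= (IH (ltnW jn)) exprS; lra.
have d0 : d 0%N = 0.
  have := dprv 0%N n0; rewrite /prv /= (dsign n.-1) ?ltn_predL //.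
  rewrite -signr_odd; have /negbTE -> : ~~ odd n.-1 by move: n_odd n0; case: (n).
  by rewrite expr0 mul1r; lra.
have hE j : (j < n)%N -> edge_val x (he 1 j) = edge_val x (he 0 j).
  by move=> jn; have := dsign j jn; rewrite d0 mulr0 /d; lra.
have veE i j : (i < 2)%N -> (j < n)%N -> ve i j = ve 0 j.
  by move=> k2 jn; apply/eqP; rewrite (vedge_eq tE) // !eqxx orbT.
have xE : x = \row_k edge_val x (enum_val k).
  by apply/rowP => k; rewrite mxE edge_val_enum.
rewrite [LHS]xE (tvec_edges tE) //; apply: tvec_ext => i j i2 jn.
  by case: i i2 => [|[|]] // _; rewrite hE.
rewrite veE // (cone_vsum u (v 0 j) Kx) vsum_edges // /vweight eqxx.
by field.
Qed.

(** The point [p] is 1 on the cycles and [r - 2] on the rungs. The numerical hypotheses make it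
    interior and its rung inequality strict; the last hypothesis is then the subtraction of [p] from
    an interior lattice point, expressed in cycle values. *)
Lemma prism_Gorenstein (r : nat) (p : 'rV[int]_#|E|) : (2 < r)%N ->
  map_mx intr p = prism (fun=> 1) r%:R ->
  (2 < n.-1 * (r - 2))%N -> (r < n * (r - 2))%N ->
  (forall (A : nat -> int) (S : int), (forall j, (j < n)%N -> 1 <= A j) ->
    (forall j, (j < n)%N -> 1 <= S - A j - A (prv n j)) ->
    S < \sum_(j < n) (S - A j - A (prv n j)) ->
    cone (prism (fun j => (A j - 1)%:~R) (S - r%:Z)%:~R)) ->
  Gorenstein (pm_polytope E R).
Proof.
move=> r2 pE nr rn H.
have r2E : (r - 2)%:R = r%:R - 2 :> R by rewrite natrB // ltnW.
have Ip : icone (prism (fun=> 1) r%:R).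
  apply: (sym_icone tE) => //.
  move: nr; rewrite -(ltr_nat R) natrM r2E; lra.
apply: (@Gorenstein_intro _ _ _ (v 0 0) p r).
- by apply: leq_trans r2.
- by rewrite pE.
- by rewrite pE vsum_prism.
move=> z Iz; pose A j := edge_val z (he 0 j).
have [S vS] : exists S : int, vsum (map_mx (intr : int -> R) z) (v 0 0) = S%:~R.
  by rewrite vsum_toR; eexists.
have zE : map_mx intr z = prism (fun j => (A j)%:~R) S%:~R.
  rewrite [LHS](cone_prism (v 0 0) (icone_cone Iz)) vS.
  by apply: prism_ext => // j jn; rewrite edge_val_toR.
have z1 e : e \in E -> 1 <= edge_val z e.
  move=> eE; suff : 0 < edge_val (map_mx (intr : int -> R) z) e.
    by rewrite edge_val_toR ltr0z.
  apply: edge_val_gt0 => // k; apply: (icone_gt0 Iz (icone_cone Ip)).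
  by apply: tvec_gt0 => // i j _ _; rewrite divr_gt0 //; rewrite -(ltr_nat R) in r2; lra.
have cE j : (j < n)%N -> edge_val z (ve 0 j) = S - A j - A (prv n j).
  move=> jn; apply: (@intr_inj R); rewrite -edge_val_toR zE edge_val_tvec_rung //.
  by rewrite !rmorphB /=; field.
rewrite map_mxB zE pE prismB.
rewrite (prism_ext (b := fun j => (A j - 1)%:~R) (t := (S - r%:Z)%:~R)).
- apply: H => [j jn|j jn|].
  + by apply: z1; exact: (hedge_edge tE).
  + by rewrite -cE //; apply: z1; exact: (vedge_edge tE).
  + rewrite -(ltr_int R) rmorph_sum /=.
    have : vsum (map_mx intr z) (v 0 0) <
        \sum_(j < n) edge_val (map_mx (intr : int -> R) z) (ve 0 j).
      apply: (rung_sum_gt _ Iz (icone_cone Ip)).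
      rewrite sumr_const card_ord -mulr_natl.
      by move: rn; rewrite -(ltr_nat R) natrM r2E; lra.
    rewrite vS (eq_bigr (fun j : 'I_n => (S - A j - A (prv n j))%:~R)) // => j _.
    by rewrite edge_val_toR cE.
- by move=> j jn; rewrite rmorphB.
- by rewrite rmorphB.
Qed.


(** The last hypothesis lets [s] be divided into parts at least [a 0], [a 1] and [a 2]; each piece
    has a single nonzero cycle value and is cut elsewhere. *)
Lemma prism3_cone (a : nat -> R) s : n = 3%N ->
  0 <= a 0%N -> 0 <= a 1%N -> 0 <= a 2%N -> a 0%N + a 1%N + a 2%N <= s ->
  cone (prism a s).
Proof.
move=> n3 a0 a1 a2 as_.
pose d (b : nat) (c : R) (j : nat) : R := if j == b then c else 0.
have piece b c t : (b < 3)%N -> 0 <= c -> c <= t -> cone (prism (d b c) t).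
  move=> b3 c0 ct.
  have Hd2 : forall j, (j < n)%N -> d b c j + d b c (prv n j) <= t.
    rewrite n3 /d => j; case: b b3 => [|[|[|]]] // _; case: j => [|[|[|]]] // _ /=; lra.
  have Hd : forall j, (j < n)%N -> 0 <= d b c j by move=> j _; rewrite /d; case: ifP.
  have [b0|b0] := eqVneq b 0%N.
    by apply: (@prism_cut _ _ 1%N) => //; rewrite ?n3 // /d b0.
  by apply: (@prism_cut _ _ 0%N) => //; rewrite /d eq_sym (negbTE b0).
rewrite (prism_ext (b := fun j => d 0%N (a 0%N) j + d 1%N (a 1%N) j + d 2%N (a 2%N) j)
  (t := a 0%N + a 1%N + (s - a 0%N - a 1%N))); last by ring.
  rewrite -!prismD; do 2?apply: coneD; apply: piece => //; lra.
by rewrite n3 /d; case=> [|[|[|]]] //= _; ring.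
Qed.

(* The step case subtracts as much as possible of the matching of edges 0 and 2;
   the process stops at a missing edge or at a rung with zero weight. *)
Lemma prism5_cone (a : nat -> R) s : n = 5%N ->
  (forall j, (j < 5)%N -> 0 <= a j) ->
  (forall j, (j < 5)%N -> a j + a (prv 5 j) <= s) ->
  a 0%N + a 1%N + a 2%N + a 3%N + a 4%N <= 2 * s ->
  cone (prism a s).
Proof.
move=> n5.
pose q (c0 c1 c2 c3 c4 : R) := nth 0 [:: c0; c1; c2; c3; c4].
suff H : forall c0 c1 c2 c3 c4 t, 0 <= c0 -> 0 <= c1 -> 0 <= c2 -> 0 <= c3 -> 0 <= c4 ->
    c0 + c4 <= t -> c1 + c0 <= t -> c2 + c1 <= t -> c3 + c2 <= t -> c4 + c3 <= t ->
    c0 + c1 + c2 + c3 + c4 <= 2 * t -> cone (prism (q c0 c1 c2 c3 c4) t).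
  move=> a_ge0 aa asum.
  rewrite (prism_ext (b := q (a 0%N) (a 1%N) (a 2%N) (a 3%N) (a 4%N)) (t := s)) //.
    apply: H; rewrite ?a_ge0 //.
    - exact: (aa 0%N).
    - exact: (aa 1%N).
    - exact: (aa 2%N).
    - exact: (aa 3%N).
    - exact: (aa 4%N).
  by rewrite n5; case=> [|[|[|[|[|]]]]].
have cut j0 : (j0 < 5)%N -> forall c0 c1 c2 c3 c4 t,
    0 <= c0 -> 0 <= c1 -> 0 <= c2 -> 0 <= c3 -> 0 <= c4 ->
    c0 + c4 <= t -> c1 + c0 <= t -> c2 + c1 <= t -> c3 + c2 <= t -> c4 + c3 <= t ->
    q c0 c1 c2 c3 c4 j0 = 0 -> cone (prism (q c0 c1 c2 c3 c4) t).
  move=> j05 c0 c1 c2 c3 c4 t ? ? ? ? ? ? ? ? ? ? qj0.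
  apply: (@prism_cut _ _ j0) => //; rewrite n5 //.
    by case=> [|[|[|[|[|]]]]].
  by case=> [|[|[|[|[|]]]]].
have tight c0 c1 c2 c3 c4 t : 0 <= c0 -> 0 <= c1 -> 0 <= c2 -> 0 <= c3 -> 0 <= c4 ->
    c0 + c4 <= t -> c1 + c0 <= t -> c2 + c1 <= t -> c3 + c2 <= t -> c4 + c3 = t ->
    c0 + c1 + c2 + c3 + c4 <= 2 * t -> cone (prism (q c0 c1 c2 c3 c4) t).
  move=> ? ? ? ? ? ? ? ? ? ct ?.
  (* Rung 4 is zero, so the vector is split into parts of vertex sums [c3] and [c4], using edge 3
     and edge 4 respectively. The share [al] of edge 1 fits the first part, and by the bound on the
     total the rest fits the second. *)
  pose al := Num.min c1 (c3 - c0).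
  have [al0 al1 al2 al3] : [/\ 0 <= al, al <= c1, al <= c3 - c0 & c1 - al <= c4 - c2].
    by rewrite /al; case: (lerP c1 (c3 - c0)) => ?; split; lra.
  rewrite (prism_ext (b := fun j => q c0 al 0 c3 0 j + q 0 (c1 - al) c2 0 c4 j)
    (t := c3 + c4)); last by rewrite -ct addrC.
    rewrite -prismD; apply: coneD.
      by apply: (cut 2%N) => //; lra.
    by apply: (cut 0%N) => //; lra.
  by rewrite n5 /q; case=> [|[|[|[|[|]]]]] //= _; ring.
move=> c0 c1 c2 c3 c4 t ? ? ? ? ? ? ? ? ? ? ?.
(* The last bound is the weight of rung 4, the rung completing the matching of edges 0 and 2. *)
pose th := Num.min (Num.min c0 c2) (t - c4 - c3).
have [th0 th1 th2 th3] : [/\ 0 <= th, th <= c0, th <= c2 & c4 + c3 <= t - th].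
  rewrite /th; case: (lerP c0 c2) => ?.
    by case: (lerP c0 (t - c4 - c3)) => ?; split; lra.
  by case: (lerP c2 (t - c4 - c3)) => ?; split; lra.
rewrite (prism_ext (b := fun j => q th 0 th 0 0 j + q (c0 - th) c1 (c2 - th) c3 c4 j)
  (t := th + (t - th))); last by ring.
  rewrite -prismD; apply: coneD; first by apply: (cut 1%N) => //; lra.
  have [e|e] : (c0 = th \/ c2 = th) \/ c4 + c3 = t - th.
    rewrite /th; case: (lerP c0 c2) => ?.
      by case: (lerP c0 (t - c4 - c3)) => ?; [left; left|right; lra].
    by case: (lerP c2 (t - c4 - c3)) => ?; [left; right|right; lra].
    case: e => e; [apply: (cut 0%N) => //|apply: (cut 2%N) => //]; rewrite /q /=; lra.
  by apply: tight => //; lra.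
by rewrite n5 /q; case=> [|[|[|[|[|]]]]] //= _; ring.
Qed.

Lemma prism3_Gorenstein : n = 3%N -> Gorenstein (pm_polytope E R).
Proof.
(* Both index pairs of a rung contribute 1, so [p] has value 2 on rungs and vertex sum 4. The
   all-ones vector has three rungs and vertex sum 3, which is equality in [rung_sum_ge]. *)
move=> n3; apply: (@prism_Gorenstein 4 (tvec 2 n v E (fun _ _ => 1) (fun _ _ => 1))).
- by [].
- by rewrite map_tvec; apply: tvec_ext => // i j _ _; field.
- by rewrite n3.
- by rewrite n3.
move=> A S A1 _ AS.
apply: prism3_cone => //; rewrite -?rmorphD ?ler0z ?ler_int.
- by rewrite subr_ge0 A1 // n3.
- by rewrite subr_ge0 A1 // n3.
- by rewrite subr_ge0 A1 // n3.
(* Strictness says that [S] exceeds the sum of the [A j], so [S - 4] is at least that sum minus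
   3. *)
move: AS; rewrite n3 !big_ord_recr big_ord0 /= /prv /=; lia.
Qed.

Lemma prism5_Gorenstein : n = 5%N -> Gorenstein (pm_polytope E R).
Proof.
move=> n5; apply: (@prism_Gorenstein 3 (const_mx 1)).
- by [].
- have -> : map_mx intr (const_mx 1) = const_mx 1 :> 'rV[R]_#|E|.
    by apply/rowP => k; rewrite !mxE.
  rewrite (const1_tvec _ tE) //; apply: tvec_ext => // i j _ _.
  by rewrite /vweight eqxx; field.
- by rewrite n5.
- by rewrite n5.
move=> A S A1 AA AS.
apply: prism5_cone => //.
- by move=> j j5; rewrite ler0z subr_ge0 A1 // n5.
- move=> j j5; rewrite -rmorphD ler_int.
  by have := AA j; rewrite n5 => /(_ j5); lia.
rewrite -?rmorphD -[2 in leRHS]/(2%:~R) -rmorphM ler_int.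
(* Strictness says that [2 * S] exceeds the sum of the [A j], so [2 * (S - 3)] is at least that sum
   minus 5. *)
move: AS; rewrite n5 !big_ord_recr big_ord0 /= /prv /=; lia.
Qed.

End Prism.

(** * Torus polytopes *)

Lemma torus_on_swap (V : finType) m n (v : nat -> nat -> V) E :
  torus_on m n v E -> torus_on n m (fun i j => v j i) E.
Proof.
case=> m0 n0 v_inj v_surj edgeP; split=> //.
- by move=> i j k l im jn km ln /v_inj [] // -> ->.
- by move=> u; have [i [j [im jn ->]]] := v_surj u; exists j, i.
move=> e; split=> [/edgeP[e2 [i [j [im jn ee]]]]|[e2 [i [j [im jn ee]]]]].
  by split=> //; exists j, i; split => //; case: ee => ->; [right|left].
by apply/edgeP; split=> //; exists j, i; split => //; case: ee => ->; [right|left].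
Qed.

Section TorusCoordinates.
Variables m n : nat.
Hypotheses (m0 : (0 < m)%N) (n0 : (0 < n)%N).

Definition tvertex (i j : nat) : 'I_m * 'I_n :=
  (Ordinal (ltn_pmod i m0), Ordinal (ltn_pmod j n0)).

Lemma tvertex_ord (u : 'I_m * 'I_n) : tvertex u.1 u.2 = u.
Proof. by case: u => i j; congr (_, _); apply/val_inj; rewrite /= modn_small. Qed.

Lemma tvertex_inj i j k l : (i < m)%N -> (j < n)%N -> (k < m)%N -> (l < n)%N ->
  tvertex i j = tvertex k l -> i = k /\ j = l.
Proof. by move=> im jn km ln [] /=; rewrite !modn_small. Qed.

Lemma torus_adjP i j k l : (i < m)%N -> (j < n)%N -> (k < m)%N -> (l < n)%N ->
  torus_adj (tvertex i j) (tvertex k l) <-> tvertex i j != tvertex k l /\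
  ((i = k /\ (l = nxt n j \/ j = nxt n l)) \/
   (j = l /\ (k = nxt m i \/ i = nxt m k))).
Proof.
move=> im jn km ln.
have neqE : (tvertex i j != tvertex k l) = (i != k) || (j != l).
  rewrite -negb_and; congr (~~ _); apply/eqP/andP => [/tvertex_inj[] // -> ->|] //.
  by case=> /eqP -> /eqP ->.
rewrite /torus_adj neqE -!val_eqE /= !modn_small //.
have nxtE a b c : (a < c)%N -> (b < c)%N -> a = nxt c b <->
    (a == b.+1) || ((a == 0%N) && (b == c.-1)).
  by rewrite /nxt => ac bc; case: (eqVneq b.+1 c) => ?; lia.
rewrite !nxtE // {neqE nxtE}; split; last first.
  by case=> -> /= h; lia.
by case/andP=> -> h; split => //; lia.
Qed.

Lemma torus_coordinates : torus_on m n tvertex (torus_edges m n).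
Proof.
split=> //; first exact: tvertex_inj.
  by move=> u; exists u.1, u.2; rewrite tvertex_ord; split.
move=> e; rewrite inE; split.
  case/existsP=> u /existsP[w /andP[+ /eqP ->]].
  rewrite -(tvertex_ord u) -(tvertex_ord w).
  have := ltn_ord u.1; have := ltn_ord u.2; have := ltn_ord w.1; have := ltn_ord w.2.
  move: (nat_of_ord u.1) (nat_of_ord u.2) (nat_of_ord w.1) (nat_of_ord w.2).
  move=> i j k l ln km jn im /torus_adjP[] // uw adj.
  split; first by rewrite cards2 uw.
  case: adj => [[ik [lE|jE]]|[jl [kE|iE]]].
  - by exists i, j; split=> //; left; rewrite /hedge -lE ik.
  - by exists i, l; split=> //; left; rewrite /hedge -jE ik finset.setUC.
  - by exists i, j; split=> //; right; rewrite /vedge -kE jl.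
  - by exists k, j; split=> //; right; rewrite /vedge -iE jl finset.setUC.
case=> + [i [j [im jn ee]]]; case: ee => ->; rewrite cards2 => e2;
  apply/existsP; exists (tvertex i j); apply/existsP.
  exists (tvertex i (nxt n j)); rewrite eqxx andbT; apply/torus_adjP; rewrite ?nxt_lt //.
  by split; [case: eqP e2|left; split => //; left].
exists (tvertex (nxt m i) j); rewrite eqxx andbT; apply/torus_adjP; rewrite ?nxt_lt //.
by split; [case: eqP e2|right; split => //; left].
Qed.

End TorusCoordinates.

(** For even n the wrap-around step goes from the odd n - 1 to 0; for n = 1 it is a loop. *)
Lemma nxt_odd n j : (n = 1%N \/ ~~ odd n) -> (j < n)%N -> nxt n j != j ->
  odd (nxt n j) = ~~ odd j.
Proof.
rewrite /nxt; case: (eqVneq j.+1 n) => [<-|] //= [[->]|].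
  by rewrite eqxx.
by rewrite negbK => ->.
Qed.

(** The chessboard colouring is proper, a side of length 1 giving only loops, and translations make
    the graph regular. A side longer than 1 ensures positive degree. *)
Lemma even_torus_Gorenstein (R : realType) (V : finType) m n (v : nat -> nat -> V) E :
  torus_on m n v E -> (m = 1%N \/ ~~ odd m) -> (n = 1%N \/ ~~ odd n) ->
  (1 < m)%N || (1 < n)%N -> Gorenstein (pm_polytope E R).
Proof.
move=> tE em en mn; have m0 := torus_m_gt0 tE; have n0 := torus_n_gt0 tE.
pose col u := odd (cx tE u + cy tE u).
apply: (@regular_bipartite_Gorenstein R V E col (degree E (v 0 0)) (v 0 0)).
- apply/card_gt0P; case/orP: mn => lt1.
    exists (vedge m v 0 0); rewrite inE !inE eqxx /= andbT; apply/(torus_edgeP tE).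
    split; last by exists 0%N, 0%N; split => //; right.
    by rewrite cards2 (v_eq tE) ?nxt_lt // eqxx andbT eq_sym nxt_neq.
  exists (hedge n v 0 0); rewrite inE !inE eqxx /= andbT; apply/(torus_edgeP tE).
  split; last by exists 0%N, 0%N; split => //; left.
  by rewrite cards2 (v_eq tE) ?nxt_lt // eqxx /= eq_sym nxt_neq.
- move=> e /(torus_edgeP tE)[+ [i [j [im jn ee]]]].
  case: ee => -> {e}; rewrite cards2 (v_eq tE) ?nxt_lt // eqxx ?andbT /= => e2.
    exists (v i j), (v i (nxt n j)); split => //.
    rewrite /col !cxE ?cyE ?nxt_lt // !oddD nxt_odd //; last first.
      by rewrite eq_sym; case: eqP e2.
    by case: (odd i); case: (odd j).
  exists (v i j), (v (nxt m i) j); split => //.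
  rewrite /col !cxE ?cyE ?nxt_lt // !oddD nxt_odd //; last first.
    by rewrite eq_sym; case: eqP e2.
  by case: (odd i); case: (odd j).
- by move=> u; exact: (torus_regular tE).
Qed.

Lemma even_odd_torus_Gorenstein (R : realType) (V : finType) m n
    (v : nat -> nat -> V) E :
  torus_on m n v E -> ~~ odd m -> odd n -> (1 < n)%N ->
  Gorenstein (pm_polytope E R) <-> (m, n) = (2, 3)%N \/ (m, n) = (2, 5)%N.
Proof.
move=> tE em on n1; have m0 := torus_m_gt0 tE.
have m1 : (1 < m)%N by case: m em m0 {tE} => [|[|]].
have n2 : (2 < n)%N by case: n on n1 {tE} => [|[|[|]]].
split=> [G|[[mE nE]|[mE nE]]]; last 2 first.
- by subst m n; exact: (prism3_Gorenstein R tE).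
- by subst m n; exact: (prism5_Gorenstein R tE).
have [m2|m2] := eqVneq m 2%N.
  subst m; have [n7|n7] := ltnP 6 n; last first.
    by case: n on n2 n7 {tE n1 G} => [|[|[|[|[|[|[|]]]]]]] //; [left|right].
  (* With vertical weight 1/2 the condition reads 4 < n - 1. *)
  exfalso; move: G; apply: (not_Gorenstein_rows tE) => //; rewrite /vweight eqxx.
  by rewrite -[2]/(2%:R) ltr_pdivlMr // -natrM ltr_nat; lia.
have m4 : (3 < m)%N by case: m em m0 m1 m2 {tE G} => [|[|[|[|]]]].
have [n3|n3] := eqVneq n 3%N.
  by subst n; exfalso; move: G; exact: (not_Gorenstein_three tE m4 em).
(* With vertical weight 1 the condition reads 2 < n - 1, true for odd n from 5 on. *)
exfalso; move: G; apply: (not_Gorenstein_rows tE) => //; rewrite /vweight (negbTE m2) mulr1 ltr_nat.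
lia.
Qed.

Local Close Scope ring_scope.

Theorem theorem1p4 (R : realType) (m n : nat) :
  (0 < m)%N -> (0 < n)%N -> ~~ odd (m * n) ->
  Gorenstein (torus_polytope R m n) <->
  exists a b : nat,
    ((a, b) = (m, n) \/ (a, b) = (n, m)) /\
    (((a = 1%N \/ ~~ odd a) /\ ~~ odd b) \/
     ((a, b) = (2, 3) \/ (a, b) = (2, 5))).
Proof.
move=> m0 n0 omn; rewrite /torus_polytope.
have tE := torus_coordinates m0 n0; have tE' := torus_on_swap tE.
have [em|om] := boolP (odd m); have [en|on] := boolP (odd n).
- by rewrite oddM em en in omn.
- have [m1|m1] := ltnP 1 m; last first.
    have mE : m = 1%N by apply/eqP; rewrite eqn_leq m1.
    split=> _; first by exists m, n; split; [left|left; split; [left|]].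
    apply: (even_torus_Gorenstein R tE); [by left|by right|].
    by case: n n0 on {tE tE' omn} => [|[|]] // k _ _; rewrite orbT.
  (* The swapped coordinates put the even side first. *)
  rewrite (even_odd_torus_Gorenstein R tE' on em m1); split=> [nm|].
    by exists n, m; split; right.
  case=> a [b [[[-> ->]|[-> ->]] [[[a1|ea] eb]|//]]].
  - by rewrite a1 in m1.
  - by rewrite em in ea.
  - by case=> -[mE nE]; move: em; rewrite mE.
  - by rewrite em in eb.
  - by rewrite em in eb.
- have [n1|n1] := ltnP 1 n; last first.
    have nE : n = 1%N by apply/eqP; rewrite eqn_leq n1.
    split=> _; first by exists n, m; split; [right|left; split; [left|]].
    apply: (even_torus_Gorenstein R tE); [by right|by left|].
    by case: m m0 om {tE tE' omn} => [|[|]].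
  rewrite (even_odd_torus_Gorenstein R tE om en n1); split=> [mn|].
    by exists m, n; split; [left|right].
  case=> a [b [[[-> ->]|[-> ->]] [[[a1|ea] eb]|//]]].
  - by rewrite en in eb.
  - by rewrite en in eb.
  - by rewrite a1 in n1.
  - by rewrite en in ea.
  - by case=> -[nE mE]; move: en; rewrite nE.
- split=> _; first by exists m, n; split; [left|left; split; [right|]].
  apply: (even_torus_Gorenstein R tE); [by right|by right|].
  by case: m m0 om {tE tE' omn} => [|[|]].
Qed.
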